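(* Let $d\ge 1$ and $n\ge d+1$ be fixed. Elementwise on the underlying probability space (on the almost sure event that $X_1,\ldots,X_n$ are pairwise distinct and $S_n$ is invertible), we have $$\lim_{a\to 0^+}\left[\left(\frac{a}{\pi}\right)^{d/2}U_{n,a}-\frac{d(d+2)}{4a^2}\right]=\frac1n\sum_{j=1}^n\|Y_{n,j}\|^4-d^2 .$$
   Context: $X_1,\ldots,X_n$ are i.i.d. $d$-dimensional random column vectors whose common distribution is absolutely continuous with respect to Lebesgue measure on $\mathbb{R}^d$; $\|\cdot\|$ is the Euclidean norm. Put $\overline X_n=n^{-1}\sum_{j=1}^nX_j$ and $S_n=n^{-1}\sum_{j=1}^n(X_j-\overline X_n)(X_j-\overline X_n)^\top$ (almost surely invertible since $n\ge d+1$). The scaled residuals are $Y_{n,j}=S_n^{-1/2}(X_j-\overline X_n)$, $j=1,\ldots,n$, where $S_n^{-1/2}$ is the unique symmetric positive definite square root of $S_n^{-1}$. Their empirical characteristic function is $\psi_n(t)=n^{-1}\sum_{j=1}^n\exp(\mathrm{i}t^\top Y_{n,j})$, $t\in\mathbb{R}^d$. With $\Delta$ the Laplace operator and $w_a(t)=\exp(-a\|t\|^2)$, for $a>0$ define $$U_{n,a}=n\int_{\mathbb{R}^d}\left|\Delta\psi_n(t)-\left(\|t\|^2-d\right)\psi_n(t)\right|^2w_a(t)\,\mathrm{d}t .$$ *)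

(* Defs.v *)
(* MathComp and MathComp-Analysis, with R[i] from mathcomp-real-closed *)
From HB Require Import structures.
From mathcomp Require Import all_boot all_order all_algebra.
From mathcomp Require Import complex.
From mathcomp Require Import all_classical all_reals all_analysis.

Set Implicit Arguments.
Unset Strict Implicit.
Unset Printing Implicit Defensive.

Import Order.TTheory GRing.Theory Num.Theory.
Import numFieldTopology.Exports numFieldNormedType.Exports.

Local Open Scope classical_set_scope.
Local Open Scope ring_scope.

Definition measure_cV_display : measure_display -> measure_display.
Proof. exact. Qed.

Section measurable_cV.
Context {d : measure_display} {T : sigmaRingType d} (n : nat).

Let coord : 'I_n -> 'cV[T]_n -> T := fun i v => v i ord0.

Let cV_set0 : g_sigma_preimage coord set0.
Proof. exact: sigma_algebra0. Qed.

Let cV_setC A : g_sigma_preimage coord A -> g_sigma_preimage coord (~` A).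
Proof. exact: sigma_algebraC. Qed.

Let cV_bigcup (F : (set 'cV[T]_n)^nat) :
  (forall i, g_sigma_preimage coord (F i)) ->
  g_sigma_preimage coord (\bigcup_i (F i)).
Proof. exact: sigma_algebra_bigcup. Qed.

(* The product sigma-algebra, generated by the coordinates: for T := R it is
   the Borel sigma-algebra of R^n. *)
HB.instance Definition _ := @isMeasurable.Build (measure_cV_display d)
  'cV[T]_n (g_sigma_preimage coord) cV_set0 cV_setC cV_bigcup.

End measurable_cV.

Section measurable_cV_lemmas.
Context {d d' : measure_display} {T : measurableType d}.

Lemma measurable_coord n (i : 'I_n) :
  measurable_fun [set: 'cV[T]_n] (fun v : 'cV[T]_n => v i ord0).
Proof.
move=> _ Y mY; rewrite setTI; apply: sub_sigma_algebra => /=.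
rewrite -bigcup_seq/=; exists i => /=; first by rewrite mem_index_enum.
by exists Y => //; rewrite setTI.
Qed.

Lemma measurable_fun_coordP (T1 : measurableType d') n (f : T1 -> 'cV[T]_n) :
  (forall i, measurable_fun [set: T1] (fun x => f x i ord0)) ->
  measurable_fun [set: T1] f.
Proof.
move=> mf _ A mA; rewrite setTI.
suff : g_sigma_preimage (fun i => (fun v : 'cV[T]_n => v i ord0) \o f)
    `<=` measurable.
  apply; rewrite g_sigma_preimage_comp.
  by exists A => //; rewrite setTI.
apply: smallest_sub; first exact: sigma_algebra_measurable.
case: n => [|n] in f mf A mA *; first by rewrite big_ord0.
rewrite -bigcup_mkord_ord; apply: bigcup_sub => i Ii.
by move=> B [C mC <-]; exact: mf.
Qed.

End measurable_cV_lemmas.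

Section lebesgue_cV.
Context {R : realType}.

Definition cons_cV n (xv : measurableTypeR R * 'cV[R]_n) : 'cV[R]_n.+1 :=
  col_mx (xv.1%:M : 'M[R]_1) xv.2.

Definition uncons_cV n (v : 'cV[R]_n.+1) : measurableTypeR R * 'cV[R]_n :=
  (v ord0 ord0, dsubmx (v : 'cV[R]_(1 + n))).

Lemma cons_cVK n : cancel (@cons_cV n) (@uncons_cV n).
Proof.
move=> [x v]; rewrite /uncons_cV /cons_cV /= col_mxKd; congr pair.
have -> : (ord0 : 'I_(1 + n)) = lshift n ord0 by exact/val_inj.
by rewrite [LHS](@col_mxEu _ 1 n 1) mxE eqxx mulr1n.
Qed.

Lemma uncons_cVK n : cancel (@uncons_cV n) (@cons_cV n).
Proof.
move=> v; rewrite /uncons_cV /cons_cV /=.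
transitivity (@col_mx _ 1 n 1 (usubmx (v : 'cV[R]_(1 + n))) (dsubmx (v : 'cV[R]_(1 + n)))).
  congr (@col_mx _ 1 n 1 _ _); apply/matrixP => i j.
  rewrite !mxE !ord1 eqxx mulr1n; congr (v _ _); exact/val_inj.
exact: (@vsubmxK _ 1 n 1 v).
Qed.

Lemma measurable_cons_cV n : measurable_fun setT (@cons_cV n).
Proof.
apply: measurable_fun_coordP => i.
rewrite -(@fintype.splitK 1 n i); case: (@fintype.split 1 n i) => j /=.
  rewrite (_ : (fun _ => _) = fst); first exact: measurable_fst.
  by apply/funext => xv; rewrite [LHS](@col_mxEu _ 1 n 1) mxE !ord1 eqxx mulr1n.
rewrite (_ : (fun _ => _) = (fun v : 'cV[R]_n => v j ord0) \o snd).
  by apply: measurableT_comp; [exact: measurable_coord|exact: measurable_snd].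
by apply/funext => xv; rewrite [LHS](@col_mxEd _ 1 n 1).
Qed.

Lemma measurable_uncons_cV n : measurable_fun setT (@uncons_cV n).
Proof.
apply: measurable_fun_pair.
  exact: measurable_coord.
apply: measurable_fun_coordP => i.
rewrite [X in measurable_fun _ X](_ : _ =
  (fun v : 'cV[R]_n.+1 => v (rshift 1 i) ord0)).
  exact: measurable_coord.
by apply/funext => v; rewrite mxE.
Qed.

Section step.
Context n (m : {sigma_finite_measure set 'cV[R]_n -> \bar R}).

Definition lebesgue_cons : set 'cV[R]_n.+1 -> \bar R :=
  pushforward (@lebesgue_measure R \x m)%E (@cons_cV n).

Let lebesgue_cons0 : lebesgue_cons set0 = 0%E.
Proof. by rewrite /lebesgue_cons /pushforward preimage_set0 measure0. Qed.

Let lebesgue_cons_ge0 A : (0 <= lebesgue_cons A)%E.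
Proof. by rewrite /lebesgue_cons /pushforward; exact: measure_ge0. Qed.

Let lebesgue_cons_sigma_additive : semi_sigma_additive lebesgue_cons.
Proof.
by apply: measure_semi_sigma_additive; exact: measurable_cons_cV.
Qed.

HB.instance Definition _ := isMeasure.Build _ _ _ lebesgue_cons
  lebesgue_cons0 lebesgue_cons_ge0 lebesgue_cons_sigma_additive.

Let lebesgue_cons_sigma_finite : sigma_finite setT lebesgue_cons.
Proof.
have /sigma_finiteP[F [TF ndF Foo]] := sigma_finiteT (@lebesgue_measure R).
have /sigma_finiteP[G [TG ndG Goo]] := sigma_finiteT m.
exists (fun k => @uncons_cV n @^-1` (F k `*` G k)).
  apply/seteqP; split=> // v _.
  have [k _ Fk] : (\bigcup_k F k) (uncons_cV v).1 by rewrite -TF.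
  have [l _ Gl] : (\bigcup_k G k) (uncons_cV v).2 by rewrite -TG.
  exists (maxn k l) => //; split.
  - by move: Fk; exact/subsetPset/ndF/leq_maxl.
  - by move: Gl; exact/subsetPset/ndG/leq_maxr.
move=> k; have [mF Fk] := Foo k; have [mG Gk] := Goo k; split.
  rewrite -[X in measurable X]setTI; apply: measurable_uncons_cV => //.
  exact: measurableX.
rewrite /lebesgue_cons /pushforward -comp_preimage.
rewrite (_ : _ \o _ = id) ?preimage_id; last first.
  by apply/funext => x /=; rewrite cons_cVK.
by rewrite product_measure1E// lte_mul_pinfty// ge0_fin_numE.
Qed.

HB.instance Definition _ := Measure_isSigmaFinite.Build _ _ _ lebesgue_cons
  lebesgue_cons_sigma_finite.

End step.

(* Lebesgue measure on R^n, as the n-fold product of Lebesgue measure on R;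
   R^0 is a point of mass 1. *)
Fixpoint lebesgue_cV n : {sigma_finite_measure set 'cV[R]_n -> \bar R} :=
  match n with
  | 0 => \d_(0 : 'cV[R]_0)
  | n'.+1 => lebesgue_cons (lebesgue_cV n')
  end.

Lemma lebesgue_cV_box n (A : 'I_n -> set R) :
  (forall i, measurable (A i)) ->
  lebesgue_cV n [set v | forall i, A i (v i ord0)] =
  (\prod_(i < n) lebesgue_measure (A i))%E.
Proof.
elim: n A => [|n IH] A mA /=.
  by rewrite big_ord0 diracE mem_set//= => -[].
rewrite big_ord_recl /lebesgue_cons /pushforward.
rewrite (_ : _ @^-1` _ = A ord0 `*`
    [set v : 'cV[R]_n | forall i, A (lift ord0 i) (v i ord0)]); last first.
  have cons0 x v : @cons_cV n (x, v) ord0 ord0 = x.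
    exact: (congr1 fst (cons_cVK (x, v))).
  apply/seteqP; split=> -[x v] /=.
    move=> Av; split=> [|i] /=; first by rewrite -[x](cons0 x v); exact: Av.
    have := Av (lift ord0 i); congr (A _ _).
    rewrite (_ : lift ord0 i = rshift 1 i); last exact/val_inj.
    exact: (@col_mxEd _ 1 n 1).
  move=> [/= Ax Av] i; have [j|] := unliftP ord0 i.
    move=> ->; have := Av j; congr (A _ _).
    rewrite (_ : lift ord0 j = rshift 1 j); last exact/val_inj.
    exact/esym/(@col_mxEd _ 1 n 1).
  by move=> ->; rewrite cons0.
rewrite product_measure1E//; last first.
  rewrite (_ : mkset _ = \bigcap_i [set v : 'cV[R]_n |
      A (lift ord0 i) (v i ord0)]); last first.
    by apply/seteqP; split=> [v Av i _|v Av i]; exact: Av.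
  apply: fin_bigcap_measurable => // i _.
  rewrite -[X in measurable X]setTI; exact: measurable_coord.
  exact: mA.
by congr (_ * _)%E; exact: (IH (fun i => A (lift ord0 i))).
Qed.

End lebesgue_cV.

Section vectors.
Context {R : realType} {d : nat}.
Implicit Types (x y t : 'cV[R]_d) (A Q : 'M[R]_d).

Definition dot x y : R := (x^T *m y) ord0 ord0.

(* The norm `|x| on matrices is the sup norm, hence this definition. *)
Definition enorm x : R := Num.sqrt (dot x x).

Definition posdef A : Prop :=
  A^T = A /\ forall x, x != 0 -> 0 < dot x (A *m x).

(* Such a Q is unique; the default value 0 is taken only when none exists, that
   is, when A is not symmetric positive definite. *)
Definition sqrtmx A : 'M[R]_d :=
  xget 0 [set Q | posdef Q /\ Q *m Q = A].

End vectors.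

Section complex_functions.
Context {R : realType} {d : nat}.
Implicit Type f : 'cV[R]_d -> R[i].

Definition cexpi (x : R) : R[i] := (cos x +i* sin x)%C.

(* R[i] is not a normed module over R in the library, so the partial derivative
   of a complex-valued function is taken on its real and imaginary parts. *)
Definition cpartial (k : 'I_d) f (t : 'cV[R]_d) : R[i] :=
  ('D_(delta_mx k ord0) (fun s => complex.Re (f s)) t +i*
   'D_(delta_mx k ord0) (fun s => complex.Im (f s)) t)%C.

Definition laplacian f (t : 'cV[R]_d) : R[i] :=
  \sum_(k < d) cpartial k (cpartial k f) t.

End complex_functions.

Section statistic.
Context {R : realType} {d n : nat}.
Variable x : 'I_n -> 'cV[R]_d.

Definition sample_mean : 'cV[R]_d := n%:R^-1 *: \sum_(j < n) x j.

Definition sample_cov : 'M[R]_d :=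
  n%:R^-1 *: \sum_(j < n) (x j - sample_mean) *m (x j - sample_mean)^T.

Definition regular_sample : Prop := injective x /\ sample_cov \in unitmx.

Definition residual (j : 'I_n) : 'cV[R]_d :=
  sqrtmx (invmx sample_cov) *m (x j - sample_mean).

Definition psi (t : 'cV[R]_d) : R[i] :=
  n%:R^-1 * \sum_(j < n) cexpi (dot t (residual j)).

Definition weight (a : R) (t : 'cV[R]_d) : R := expR (- a * enorm t ^+ 2).

Definition statU (a : R) : \bar R :=
  (n%:R%:E * \int[lebesgue_cV d]_t
     (ComplexField.Normc.normc
        (laplacian psi t - (enorm t ^+ 2 - d%:R)%:C%C * psi t) ^+ 2
      * weight a t)%:E)%E.

End statistic.

Section iid.
Context {dT dE : measure_display} {T : measurableType dT}
  {E : measurableType dE} {R : realType} (P : probability T R) {n : nat}.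
Variable X : 'I_n -> {RV P >-> E}.

(* The product rule for subfamilies is the case B j = setT for the other j. *)
Definition mutually_independent : Prop :=
  forall B : 'I_n -> set E, (forall j, measurable (B j)) ->
    P (\bigcap_j (X j @^-1` B j)) = (\prod_(j < n) P (X j @^-1` B j))%E.

Definition identically_distributed : Prop :=
  forall (i j : 'I_n) (B : set E), measurable B ->
    distribution P (X i) B = distribution P (X j) B.

End iid.

(* Main.v *)
Require Import Defs.
From HB Require Import structures.
From mathcomp Require Import all_boot all_order all_algebra.
From mathcomp Require Import complex.
From mathcomp Require Import all_classical all_reals all_analysis.
From mathcomp Require Import measurable_realfun ring lra.

Set Implicit Arguments.
Unset Strict Implicit.
Unset Printing Implicit Defensive.

Import Order.TTheory GRing.Theory Num.Theory.
Import numFieldTopology.Exports numFieldNormedType.Exports.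

Local Open Scope classical_set_scope.
Local Open Scope ring_scope.

(** Two independent facts are proved: a regular sample occurs almost surely, and
    the limit holds for every regular sample.

    Limit.  Write Y_j for the residuals and alpha_j = |Y_j|^2 - d.  Since the
    Laplacian multiplies exp(i t.Y_j) by -|Y_j|^2, the integrand of the statistic
    is, up to the weight, the square modulus of the trigonometric sum with
    coefficients -(|t|^2 + alpha_j)/n and frequencies Y_j.  Expanding that square
    gives n^-2 times the sum over j, k of

      (|t|^2 + alpha_j) (|t|^2 + alpha_k) cos(t.(Y_j - Y_k)),

    so that only Gaussian integrals of monomials times a cosine of frequency
    y = Y_j - Y_k are needed.  With c = 1/(2a), such an integral equals
    (pi/a)^(d/2) exp(-c|y|^2/2) times a polynomial in c ([has_integral_pair]).
    If j <> k then y <> 0, because the residuals are pairwise distinct, and the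
    term tends to 0 as c tends to infinity ([cvg_poly_expR]).  If j = k, the
    polynomial is d(d+2) c^2 + 2 d alpha_j c + alpha_j^2 ([pair_poly0]).  Its first
    term is the subtracted d(d+2)/(4a^2).  The second vanishes after summation,
    since the residuals have empirical covariance 1, whence sum_j |Y_j|^2 = n d
    ([sum_residual_sqr]).  The third sums to the announced limit.

    The Gaussian integrals are computed on the line and then multiplied by Fubini.
    On the line, a differential equation in the frequency gives the moment of order
    0 and an integration by parts gives the others.  Carrying an arbitrary phase
    phi in cos(phi + t.y) replaces complex exponentials throughout: the phase
    absorbs the contribution of the other coordinates in the Fubini induction, and
    a shift by pi/2 plays the part of a derivative.

    The residuals are meaningful because a symmetric positive definite matrix has
    a symmetric positive definite square root ([posdef_sqrt]), obtained as a
    polynomial in the matrix from the complex spectral theorem.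

    Regularity.  If the sample covariance is singular, then the whole sample, and
    in particular its first d+1 points, lies on an affine hyperplane.  Hence for
    some k <= d the first k points are affinely independent, but the first k+1 are
    not: the point of index k lies on a hyperplane determined by the k previous
    ones ([gram_det_hyperplane]).  By independence, the joint law does not change
    when that point is redrawn independently of everything else
    ([joint_resample]), so by Fubini such an event has probability 0, since
    hyperplanes are Lebesgue null.  Coincidences X_i = X_j are handled in the same
    way. *)

(** * Gaussian moments on the line *)

Section gaussian_moments.
Context {R : realType}.
Implicit Types a y t phi : R.

(** The phase [phi] lets one family contain both cosines and sines: a derivative
    in [t] or in [y] shifts it by [pi / 2]. *)
Definition gauss_trig a k phi y t : R :=
  t ^+ k * cos (phi + t * y) * expR (- a * t ^+ 2).

Lemma is_derive_affine (b c x : R) : is_derive x 1 (fun x => b + x * c) c.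
Proof.
have := is_deriveD (is_derive_cst b x 1)
  (is_deriveM (is_derive_id x 1) (is_derive_cst c x 1)).
by move=> /is_derive_eq; apply; rewrite /GRing.scale/= mulr0 !add0r mulr1.
Qed.

Lemma is_derive_exprn k (x : R) : is_derive x 1 (fun x => x ^+ k) (k%:R * x ^+ k.-1).
Proof.
have := is_deriveX k (is_derive_id x 1).
rewrite /GRing.scale/= mulr1; congr (is_derive _ _ _ _).
by apply/funext => z; rewrite exprfctE.
Qed.

Lemma is_derive_gauss_trig a k phi y t :
  is_derive t 1 (gauss_trig a k phi y)
    (k%:R * gauss_trig a k.-1 phi y t + y * gauss_trig a k (phi + pi / 2) y t
     - 2 * a * gauss_trig a k.+1 phi y t).
Proof.
have D1 : is_derive t 1 (fun t => phi + t * y) y.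
  exact: is_derive_affine.
have D2 : is_derive t 1 (fun t => - a * t ^+ 2) (- a * (2 * t)).
  have := is_deriveM (is_derive_cst (- a) t 1) (is_derive_exprn 2 t).
  by move=> /is_derive_eq; apply; rewrite /GRing.scale/= mulr0 addr0 expr1.
have Dcos := @is_derive1_comp R cos _ t _ _ _ D1.
have Dexp := @is_derive1_comp R expR _ t _ _ _ D2.
have DX : is_derive t 1 (fun t => t ^+ k) (k%:R * t ^+ k.-1).
  exact: is_derive_exprn.
have := is_deriveM (is_deriveM DX (Dcos _ (is_derive_cos _))) (Dexp _ (is_derive_expR _)).
move=> /is_derive_eq; apply; rewrite /gauss_trig /GRing.scale/= !fctE /=.
have -> : cos (phi + pi / 2 + t * y) = - sin (phi + t * y).
  by rewrite addrAC cosDpihalf.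
by rewrite [t ^+ k.+1]exprS; ring.
Qed.

Lemma is_derive_gauss_trig_freq a k phi y t :
  is_derive y 1 (fun y => gauss_trig a k phi y t)
    (gauss_trig a k.+1 (phi + pi / 2) y t).
Proof.
have D1 : is_derive y 1 (fun y => phi + t * y) t.
  under eq_fun do rewrite mulrC.
  exact: is_derive_affine.
have Dcos := @is_derive1_comp R cos _ y _ _ _ D1.
have -> : (fun y => gauss_trig a k phi y t) =
   (fun y => (t ^+ k * expR (- a * t ^+ 2)) * cos (phi + t * y)).
  by apply/funext => z; rewrite /gauss_trig; ring.
have := is_deriveM (is_derive_cst (t ^+ k * expR (- a * t ^+ 2)) y 1)
  (Dcos _ (is_derive_cos _)).
move=> /is_derive_eq; apply; rewrite /gauss_trig /GRing.scale/=.
have -> : cos (phi + pi / 2 + t * y) = - sin (phi + t * y).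
  by rewrite addrAC cosDpihalf.
by rewrite [t ^+ k.+1]exprS; ring.
Qed.

Lemma continuous_gauss_trig a k phi y : continuous (gauss_trig a k phi y).
Proof.
move=> t; apply/differentiable_continuous/derivable1_diffP.
by have [] := is_derive_gauss_trig a k phi y t.
Qed.

Lemma measurable_gauss_trig a k phi y : measurable_fun setT (gauss_trig a k phi y).
Proof. apply: continuous_measurable_fun; exact: continuous_gauss_trig. Qed.

(** For u = |t^k|, this is u <= 1 + u^2. *)
Lemma norm_exprn_le k t : `|t ^+ k| <= 1 + t ^+ (2 * k).
Proof.
rewrite mulnC exprM; have := sqr_ge0 (`|t ^+ k| - 1).
have := normr_ge0 (t ^+ k); rewrite -[X in _ -> _ -> _ <= 1 + X]real_normK ?num_real//.
by set u := `| _ |; nra.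
Qed.

Lemma exprn_le_expR k (x : R) : 0 <= x -> x ^+ k <= k`!%:R * expR x.
Proof.
move=> x0; case: k => [|k].
  by rewrite expr0 fact0 mul1r -expR0 ler_expR.
have f0 : 0 < (k.+1)`!%:R :> R by rewrite ltr0n fact_gt0.
by rewrite mulrC -ler_pdivrMr// (le_trans _ (expR_ge1Dxn k x0))// lerDr.
Qed.

(** Half of the Gaussian decay absorbs the power of [t].  The bound is uniform in
    [phi] and [y], as differentiation under the integral sign requires. *)
Lemma gauss_trig_bound a k : 0 < a -> exists2 C, 0 <= C & forall phi y t,
  `|gauss_trig a k phi y t| <= C * expR (- (a / 2) * t ^+ 2).
Proof.
move=> a0; have a20 : 0 < a / 2 by rewrite divr_gt0.
have f0 : 0 <= k`!%:R * (a / 2) ^- k :> R.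
  by rewrite mulr_ge0// invr_ge0 exprn_ge0// ltW.
exists (1 + k`!%:R * (a / 2) ^- k) => [|phi y t]; first by rewrite addr_ge0.
rewrite /gauss_trig normrM [X in _ * X <= _]ger0_norm ?expR_ge0//.
have -> : - a * t ^+ 2 = - (a / 2) * t ^+ 2 + - (a / 2 * t ^+ 2) by field.
rewrite expRD [X in _ * X <= _]mulrC mulrA ler_wpM2r ?expR_ge0//.
rewrite expRN ler_pdivrMr ?expR_gt0//.
have x0 : 0 <= a / 2 * t ^+ 2 by rewrite mulr_ge0 ?sqr_ge0// ltW.
rewrite normrM (@le_trans _ _ `|t ^+ k|)//.
  by rewrite ler_piMr// ler_norml cos_geN1 cos_le1.
rewrite (le_trans (norm_exprn_le k t))// mulrDl mul1r lerD//.
  by rewrite -[leLHS]expR0 ler_expR.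
rewrite exprM mulrAC ler_pdivlMr ?exprn_gt0//.
by rewrite -exprMn mulrC exprn_le_expR.
Qed.

Let mu := @lebesgue_measure R.

(** The function is a multiple of the normal density of mean 0 and variance
    1/(2a), whose total mass is 1. *)
Lemma integral_expR_sqr a : 0 < a ->
  mu.-integrable setT (EFin \o (fun t => expR (- a * t ^+ 2))) /\
  \int[mu]_t expR (- a * t ^+ 2) = Num.sqrt (pi / a).
Proof.
move=> a0; pose s : R := Num.sqrt (2 * a)^-1.
have s20 : 0 < (2 * a)^-1 by rewrite invr_gt0 mulr_gt0.
have s0 : s != 0 by rewrite gt_eqF// sqrtr_gt0.
have s2 : s ^+ 2 = (2 * a)^-1 by rewrite sqr_sqrtr// ltW.
have K0 : Num.sqrt (pi / a) != 0.
  by rewrite gt_eqF// sqrtr_gt0 divr_gt0// pi_gt0.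
have E : (fun t => expR (- a * t ^+ 2)) =
    (fun t => Num.sqrt (pi / a) * normal_pdf 0 s t).
  apply/funext => t; rewrite normal_pdfE// /normal_peak /normal_fun s2 subr0.
  have -> : (2 * a)^-1 * pi *+ 2 = pi / a by field; rewrite gt_eqF.
  have -> : - t ^+ 2 / ((2 * a)^-1 *+ 2) = - a * t ^+ 2 by field; rewrite gt_eqF.
  by rewrite mulVKf.
have I := integrable_normal_pdf 0 s.
rewrite E; split.
  rewrite (_ : _ \o _ = fun t => ((Num.sqrt (pi / a))%:E * (normal_pdf 0 s t)%:E)%E).
    by apply: integrableZl.
  by apply/funext => t /=; rewrite EFinM.
by rewrite RintegralZl//= /Rintegral integral_normal_pdf /= mulr1.
Qed.

Lemma integrable_gauss_trig a k phi y : 0 < a ->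
  mu.-integrable setT (EFin \o gauss_trig a k phi y).
Proof.
move=> a0; have [C C0 Cub] := gauss_trig_bound k a0.
have a20 : 0 < a / 2 by rewrite divr_gt0.
apply: (@le_integrable _ _ _ mu _ measurableT _
  (fun t => C%:E * (expR (- (a / 2) * t ^+ 2))%:E)%E).
- by apply/measurable_EFinP; exact: measurable_gauss_trig.
- move=> t _ /=; rewrite lee_fin [leRHS]ger0_norm ?mulr_ge0 ?expR_ge0//.
- by apply: integrableZl => //; have [] := integral_expR_sqr a20.
Qed.

End gaussian_moments.

Section full_line.
Context {R : realType}.
Let mu := @lebesgue_measure R.

(** Integration by parts on the whole line: the integral over [-n-1, n+1] is
    F(n+1) - F(-n-1) by the fundamental theorem of calculus, and dominated
    convergence lets n tend to infinity. *)
Lemma Rintegral_derive_eq0 (F f : R -> R) :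
  (forall x : R, is_derive x 1 F (f x)) -> continuous f ->
  mu.-integrable setT (EFin \o f) ->
  F n.+1%:R @[n --> \oo] --> 0 -> F (- n.+1%:R) @[n --> \oo] --> 0 ->
  \int[mu]_t f t = 0.
Proof.
move=> dF cf If Fp Fm.
pose D n : set R := `[- n.+1%:R, n.+1%:R]%classic.
pose fn n := (EFin \o f) \_ (D n).
have mf : measurable_fun setT (EFin \o f).
  by apply/measurable_EFinP; exact: continuous_measurable_fun.
have mD n : measurable (D n) by exact: measurable_itv.
have [] := @dominated_convergence _ _ _ mu setT measurableT fn (EFin \o f)
  (abse \o (EFin \o f)) _ mf _ _ _.
- by move=> n; apply/(measurable_restrictT _ (mD n)); exact: measurable_funTS.
- apply: aeW => x _; apply: cvg_near_cst.
  near=> n; rewrite /fn patchE mem_set// /D /= in_itv /= -ler_norml.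
  apply: (@le_trans _ _ n%:R); last by rewrite ler_nat.
  by near: n; exact: nbhs_infty_ger.
- exact: integrable_abse.
- apply: aeW => x n _; rewrite /fn patchE; case: ifPn => // _.
  by rewrite abse0 abse_ge0.
move=> _ _ cvgI.
have cvgI' : (\int[mu]_t (fn n t))%E @[n --> \oo] --> 0%E.
  have intE n : (\int[mu]_t (fn n t))%E = (F n.+1%:R - F (- n.+1%:R))%:E.
    rewrite /fn -integral_mkcond /D (@continuous_FTC2 _ f F)//.
    - by rewrite ltrNl (lt_trans _ (ltr0Sn _ _))// oppr_lt0 ltr0Sn.
    - exact: continuous_subspaceT.
    - have dFx x : derivable F x 1 by have [] := dF x.
      have cF : continuous F.
        by move=> x; apply/differentiable_continuous/derivable1_diffP.
      split => [x _||]; first by have [] := dF x.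
      - apply: cvg_at_right_filter; exact: cF.
      - apply: cvg_at_left_filter; exact: cF.
    - by move=> x _; rewrite derive1E; have [_ ->] := dF x.
  under eq_fun do rewrite intE.
  apply: cvg_EFin; first exact: nearW.
  rewrite -[0]subr0; exact: cvgB.
have /cvg_unique := cvgI => /(_ (@ereal_hausdorff R) _ cvgI') I0.
by rewrite /Rintegral /= I0.
Unshelve. all: by end_near.
Qed.

End full_line.

Section moment_formula.
Context {R : realType}.
Implicit Types a y t phi : R.
Let mu := @lebesgue_measure R.

Definition gauss_moment a k phi y : R := \int[mu]_t gauss_trig a k phi y t.

Lemma gauss_trig_cvg0 a k phi y (u : nat -> R) : 0 < a ->
  (forall n, n.+1%:R <= `|u n|) -> gauss_trig a k phi y (u n) @[n --> \oo] --> 0.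
Proof.
move=> a0 un; have [C C0 Cub] := gauss_trig_bound k a0.
have a20 : 0 < a / 2 by rewrite divr_gt0.
apply: norm_cvg0.
apply: (@squeeze_cvgr _ _ _ _ (cst 0) (fun n => C * (a / 2)^-1 * harmonic n)).
- apply: nearW => n; rewrite normr_ge0 /= (le_trans (Cub _ _ _))//.
  rewrite -mulrA ler_wpM2l// mulNr expRN -invfM lef_pV2 ?posrE ?expR_gt0//.
    rewrite (@le_trans _ _ (a / 2 * u n ^+ 2))//.
      rewrite ler_pM2l// -real_normK ?num_real//.
      rewrite (le_trans (un n))// ler_peMr//.
      by rewrite (le_trans _ (un n))// ler1n.
    by rewrite (le_trans _ (expR_ge1Dx _))// lerDr.
  by rewrite mulr_gt0.
- exact: cvg_cst.
- rewrite -[X in _ --> X](mulr0 (C * (a / 2)^-1)).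
  by apply: cvgM; [exact: cvg_cst|exact: cvg_harmonic].
Qed.

(** The derivative in [t] of [gauss_trig a k phi y] has integral 0. *)
Lemma gauss_moment_rec a k phi y : 0 < a ->
  2 * a * gauss_moment a k.+1 phi y =
  k%:R * gauss_moment a k.-1 phi y + y * gauss_moment a k (phi + pi / 2) y.
Proof.
move=> a0; have I m phi' := integrable_gauss_trig m phi' y a0.
pose g m phi' := gauss_trig a m phi' y.
have IZ m phi' c : mu.-integrable setT (EFin \o (fun t => c * g m phi' t)).
  rewrite (_ : _ \o _ = fun t => (c%:E * (g m phi' t)%:E)%E); last first.
    by apply/funext => t /=; rewrite EFinM.
  by apply: integrableZl => //; exact: I.
have ID : mu.-integrable setT
    (EFin \o (fun t => k%:R * g k.-1 phi t + y * g k (phi + pi / 2) t)).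
  rewrite (_ : _ \o _ = ((EFin \o (fun t => k%:R * g k.-1 phi t)%R) \+
     (EFin \o (fun t => y * g k (phi + pi / 2) t)%R))%E)//.
  by apply: integrableD => //; exact: IZ.
have cZ m phi' c : continuous (fun t => c * g m phi' t).
  by move=> t; apply: cvgM; [exact: cvg_cst|exact: continuous_gauss_trig].
have I0 := @Rintegral_derive_eq0 R _ _ (is_derive_gauss_trig a k phi y) _ _
  (gauss_trig_cvg0 _ _ _ a0 _) (gauss_trig_cvg0 _ _ _ a0 _).
have {I0} : \int[mu]_t (k%:R * g k.-1 phi t + y * g k (phi + pi / 2) t
    - 2 * a * g k.+1 phi t) = 0.
  apply: I0 => //.
  - move=> t; apply: cvgB; last exact: cZ.
    by apply: cvgD; exact: cZ.
  - rewrite (_ : _ \o _ =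
      ((EFin \o (fun t => k%:R * g k.-1 phi t + y * g k (phi + pi / 2) t)%R) \-
       (EFin \o (fun t => 2 * a * g k.+1 phi t)%R))%E)//.
    by apply: integrableB => //; exact: IZ.
  - by move=> n; rewrite ger0_norm.
  - by move=> n; rewrite normrN ger0_norm.
rewrite RintegralB// RintegralD// !RintegralZl//; [|exact: I..].
by move=> /eqP; rewrite subr_eq0 => /eqP.
Qed.

Lemma is_derive_gauss_moment a k phi y : 0 < a ->
  is_derive y 1 (gauss_moment a k phi) (gauss_moment a k.+1 (phi + pi / 2) y).
Proof.
move=> a0; have [C C0 Cub] := gauss_trig_bound k.+1 a0.
have a20 : 0 < a / 2 by rewrite divr_gt0.
have yI : `]y - 1, y + 1[%classic y.
  by rewrite /= in_itv/= ltrDl ltrBlDr ltrDl ltr01.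
have intf x : `]y - 1, y + 1[%classic x ->
  mu.-integrable setT (EFin \o gauss_trig a k phi x).
  by move=> _; exact: integrable_gauss_trig.
have df x t : `]y - 1, y + 1[%classic x -> setT t ->
    derivable (fun z => gauss_trig a k phi z t) x 1.
  by move=> _ _; have [] := is_derive_gauss_trig_freq a k phi x t.
have pE x t : partial1of2 (gauss_trig a k phi) x t =
    gauss_trig a k.+1 (phi + pi / 2) x t.
  by rewrite partial1of2E; have [_ ->] := is_derive_gauss_trig_freq a k phi x t.
pose G t := C * expR (- (a / 2) * t ^+ 2).
have G0 t : 0 <= G t by rewrite mulr_ge0// expR_ge0.
have IG : mu.-integrable setT (EFin \o G).
  rewrite (_ : _ \o _ = fun t => (C%:E * (expR (- (a / 2) * t ^+ 2))%:E)%E).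
    by apply: integrableZl => //; have [] := integral_expR_sqr a20.
  by apply/funext => t /=; rewrite EFinM.
have Gub x t : `]y - 1, y + 1[%classic x -> setT t ->
    `|partial1of2 (gauss_trig a k phi) x t| <= G t.
  by move=> _ _; rewrite pE.
apply: DeriveDef.
  exact: (derivable_under_integral measurableT yI intf df G0 IG Gub).
rewrite -derive1E (differentiation_under_integral measurableT yI intf df G0 IG Gub).
by apply: eq_Rintegral => t _; rewrite pE.
Qed.

(** The derivative in [y] of this moment is a moment of order 1, which the
    recurrence turns into -y/(2a) times the moment itself.  Hence its product with
    exp(y^2/(4a)) is constant; at y = 0 it is the Gauss integral. *)
Lemma gauss_moment0 a phi y : 0 < a ->
  gauss_moment a 0 phi y =
  cos phi * Num.sqrt (pi / a) * expR (- y ^+ 2 / (4 * a)).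
Proof.
move=> a0; have a_neq0 : a != 0 by rewrite gt_eqF.
pose g z := gauss_moment a 0 phi z * expR (z ^+ 2 / (4 * a)).
have dg (z : R) : is_derive z 1 g 0.
  have D2 : is_derive z 1 (fun z => z ^+ 2 / (4 * a)) (2 * z / (4 * a)).
    have := is_deriveM (is_derive_exprn 2 z) (is_derive_cst (4 * a)^-1 z 1).
    by move=> /is_derive_eq; apply; rewrite /GRing.scale/= mulr0 add0r expr1 mulrC.
  have := is_deriveM (is_derive_gauss_moment 0 phi z a0)
    (@is_derive1_comp R expR _ z _ _ (is_derive_expR _) D2).
  move=> /is_derive_eq; apply; rewrite /GRing.scale/=.
  have := gauss_moment_rec 0 (phi + pi / 2) z a0.
  rewrite mul0r add0r => E.
  have -> : gauss_moment a 1 (phi + pi / 2) z =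
     z * gauss_moment a 0 (phi + pi / 2 + pi / 2) z / (2 * a).
    by rewrite -E [RHS]mulrC mulKf// mulf_neq0.
  have -> : gauss_moment a 0 (phi + pi / 2 + pi / 2) z = - gauss_moment a 0 phi z.
    rewrite /gauss_moment.
    rewrite -[RHS]mulN1r -RintegralZl//; last exact: integrable_gauss_trig.
    apply: eq_Rintegral => t _; rewrite /gauss_trig.
    have -> : phi + pi / 2 + pi / 2 + t * z = phi + t * z + pi by field.
    by rewrite cosDpi; ring.
  by field.
have := @is_derive_0_is_cst _ g y 0 dg; rewrite /g expr0n/= mul0r expR0 mulr1.
move=> /(canRL (mulfK (lt0r_neq0 (expR_gt0 _)))) ->.
rewrite mulNr expRN; congr (_ / _).
rewrite /gauss_moment; have [I <-] := integral_expR_sqr a0.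
rewrite -RintegralZl//; apply: eq_Rintegral => t _.
by rewrite /gauss_trig expr0 mul1r mulr0 addr0.
Qed.

(** The recurrence of the moments without the phase and the Gaussian factor, as
    polynomials in the variable 1/(2a); these are rescaled Hermite polynomials.
    Keeping polynomials in that variable makes the limit a -> 0 immediate. *)
Fixpoint gauss_hermite (y : R) (k : nat) : {poly R} :=
  match k with
  | 0 => 1
  | 1 => y *: 'X
  | (k'.+1 as m).+1 => 'X * (y *: gauss_hermite y m - m%:R *: gauss_hermite y k')
  end.

Lemma gauss_hermiteS y k : gauss_hermite y k.+1 =
  'X * (y *: gauss_hermite y k - k%:R *: gauss_hermite y k.-1).
Proof. by case: k => [|k] //=; rewrite scale0r subr0 alg_polyC mulrC mul_polyC. Qed.

(** Each order shifts the phase by [pi / 2].  The recurrence links orders k+2, k+1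
    and k, and the two extreme phases differ by [pi], which explains the minus sign
    in [gauss_hermite]. *)
Lemma gauss_momentE a k phi y : 0 < a ->
  gauss_moment a k phi y = cos (phi + k%:R * (pi / 2)) *
   (Num.sqrt (pi / a) * expR (- y ^+ 2 / (4 * a)) * (gauss_hermite y k).[(2 * a)^-1]).
Proof.
move=> a0; have a_neq0 : a != 0 by rewrite gt_eqF.
elim/ltn_ind: k => k IH in phi *; case: k => [|k] in IH *.
  by rewrite gauss_moment0//= mul0r addr0 hornerC mulr1 mulrA.
have E : gauss_moment a k.+1 phi y = (2 * a)^-1 *
  (k%:R * gauss_moment a k.-1 phi y + y * gauss_moment a k (phi + pi / 2) y).
  by rewrite -gauss_moment_rec// mulKf// mulf_neq0.
rewrite E (IH k)// (_ : phi + pi / 2 + k%:R * (pi / 2) = phi + k.+1%:R * (pi / 2));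
  last by rewrite -natr1; field.
rewrite gauss_hermiteS; case: k => [|k] in E IH *.
  by rewrite /= scale0r subr0 hornerM hornerX hornerZ hornerC mul0r add0r; ring.
rewrite (IH k)//= (_ : phi + k.+2%:R * (pi / 2) = phi + k%:R * (pi / 2) + pi);
  last by rewrite -!natr1; field.
by rewrite cosDpi hornerM hornerX hornerD hornerN !hornerZ; ring.
Qed.

End moment_formula.

(** * Integrals of products over R^d *)

Section product_integrals.
Context {R : realType}.
Implicit Types phi : R.

Lemma cons_cV_ord0 n (x : R) (v : 'cV[R]_n) : cons_cV (x, v) ord0 ord0 = x.
Proof. exact: (congr1 fst (cons_cVK (x, v))). Qed.

Lemma cons_cV_lift n (x : R) (v : 'cV[R]_n) i :
  cons_cV (x, v) (lift ord0 i) ord0 = v i ord0.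
Proof.
rewrite (_ : lift ord0 i = rshift 1 i); last exact/val_inj.
exact: (@col_mxEd _ 1 n 1).
Qed.

Lemma integrable_prodM d1 d2 (T1 : measurableType d1) (T2 : measurableType d2)
    (m1 : {sigma_finite_measure set T1 -> \bar R})
    (m2 : {sigma_finite_measure set T2 -> \bar R}) (f : T1 -> R) (g : T2 -> R) :
  m1.-integrable setT (EFin \o f) -> m2.-integrable setT (EFin \o g) ->
  (m1 \x m2)%E.-integrable setT (fun z => (f z.1 * g z.2)%:E).
Proof.
move=> If Ig.
have mf : measurable_fun setT f.
  by apply/measurable_EFinP; exact: measurable_int If.
have mg : measurable_fun setT g.
  by apply/measurable_EFinP; exact: measurable_int Ig.
apply/(integrable12ltyP m1 m2).
  apply/measurable_EFinP; apply: measurable_funM.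
  - exact: measurableT_comp.
  - exact: measurableT_comp.
have Ig' := integrable_abse Ig.
have If' := integrable_abse If.
have Iglt : (\int[m2]_y `|(g y)%:E| < +oo)%E by have /integrableP[] := Ig.
have Iflt : (\int[m1]_x `|(f x)%:E| < +oo)%E by have /integrableP[] := If.
under eq_integral => x _.
  under eq_integral => y _ do rewrite /= normrM EFinM.
  rewrite ge0_integralZl//; last 1 first.
    by apply/measurable_EFinP; exact: measurableT_comp.
  over.
rewrite /= ge0_integralZr//.
- by rewrite lte_mul_pinfty ?ge0_fin_numE// integral_ge0.
- by apply/measurable_EFinP; exact: measurableT_comp.
- exact: integral_ge0.
Qed.

Lemma measurable_fun_cV_prod n (h : 'I_n -> R -> R) :
  (forall i, measurable_fun setT (h i)) ->
  measurable_fun setT (fun t : 'cV[R]_n => \prod_i h i (t i ord0)).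
Proof.
move=> mh; apply: measurable_prod => i _.
by apply: measurableT_comp => //; exact: measurable_coord.
Qed.

Lemma measurable_fun_cV_phase n phi (y : 'I_n -> R) :
  measurable_fun setT (fun t : 'cV[R]_n => cos (phi + \sum_i t i ord0 * y i)).
Proof.
apply: measurableT_comp => /=.
  by apply: continuous_measurable_fun; exact: continuous_cos.
apply: measurable_funD => //; apply: measurable_sum => i.
by apply: measurable_funM => //; exact: measurable_coord.
Qed.

Lemma integrable_lebesgue_cV_prod n (h : 'I_n -> R -> R) :
  (forall i, lebesgue_measure.-integrable setT (EFin \o h i)) ->
  (lebesgue_cV n).-integrable setT (fun t => (\prod_i h i (t i ord0))%:E).
Proof.
elim: n h => [|n IH] h Ih.
  under eq_fun do rewrite big_ord0.
  apply/integrableP; split => //.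
  rewrite [X in (X < _)%E]integral_dirac//= diracE mem_set//.
  by rewrite mul1e normr1 ltry.
have mh : measurable_fun setT (fun t : 'cV[R]_n.+1 => (\prod_i h i (t i ord0))%:E).
  apply/measurable_EFinP; apply: measurable_fun_cV_prod => i.
  by apply/measurable_EFinP; exact: measurable_int (Ih i).
apply: (@integrable_pushforward _ _ _ _ R _ (measurable_cons_cV (n := n))
  (@lebesgue_measure R \x lebesgue_cV n)%E) => //.
have := integrable_prodM (Ih ord0) (IH (fun i => h (lift ord0 i)) (fun i => Ih _)).
congr integrable; apply/funext => -[x v] /=.
rewrite big_ord_recl cons_cV_ord0; congr (_ * _)%:E.
by apply: eq_bigr => i _; rewrite cons_cV_lift.
Qed.

Lemma integrable_lebesgue_cV_cos n phi (y : 'I_n -> R) (h : 'I_n -> R -> R) :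
  (forall i, lebesgue_measure.-integrable setT (EFin \o h i)) ->
  (lebesgue_cV n).-integrable setT (fun t =>
    (cos (phi + \sum_i t i ord0 * y i) * \prod_i h i (t i ord0))%:E).
Proof.
move=> Ih; apply: (le_integrable _ _ _ (integrable_lebesgue_cV_prod Ih)) => //.
  apply/measurable_EFinP; apply: measurable_funM.
    exact: measurable_fun_cV_phase.
  apply: measurable_fun_cV_prod => i.
  by apply/measurable_EFinP; exact: measurable_int (Ih i).
move=> t _ /=; rewrite lee_fin normrM ler_piMl//.
by rewrite ler_norml cos_geN1 cos_le1.
Qed.

(** A cosine of a sum is not a product, but the phase makes the induction work:
    once the first coordinate x is fixed, the inner integral is an instance of the
    statement with phase phi + x y_0, and what it returns is again a cosine of x
    with a new phase. *)
Lemma integral_lebesgue_cV_cos n (y : 'I_n -> R) (h : 'I_n -> R -> R)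
    (theta A : 'I_n -> R) :
  (forall i, lebesgue_measure.-integrable setT (EFin \o h i)) ->
  (forall i phi, (\int[lebesgue_measure]_t (cos (phi + t * y i) * h i t)%:E =
    (cos (phi + theta i) * A i)%:E)%E) ->
  forall phi, (\int[lebesgue_cV n]_t
    (cos (phi + \sum_i t i ord0 * y i) * \prod_i h i (t i ord0))%:E =
    (cos (phi + \sum_i theta i) * \prod_i A i)%:E)%E.
Proof.
elim: n y h theta A => [|n IH] y h theta A Ih hA phi.
  under eq_integral do rewrite !big_ord0.
  by rewrite integral_dirac//= diracE mem_set// mul1e !big_ord0.
have I' := integrable_lebesgue_cV_cos phi y Ih.
have Ih' i := Ih (lift ord0 i).
pose F (z : R * 'cV[R]_n) : \bar R :=
  (cos (phi + \sum_i cons_cV z i ord0 * y i) * \prod_i h i (cons_cV z i ord0))%:E.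
have FE x v : F (x, v) =
   ((h ord0 x)%:E * (cos (phi + x * y ord0 + \sum_i v i ord0 * y (lift ord0 i)) *
     \prod_i h (lift ord0 i) (v i ord0))%:E)%E.
  rewrite /F -EFinM !big_ord_recl cons_cV_ord0 addrA mulrCA.
  congr (h _ _ * (cos (_ + _) * _))%:E; apply: eq_bigr => i _;
  by rewrite cons_cV_lift.
have IF : (@lebesgue_measure R \x lebesgue_cV n)%E.-integrable setT F.
  have J := integrable_prodM (Ih ord0) (integrable_lebesgue_cV_prod Ih').
  apply: (le_integrable _ _ _ J) => //.
    have /measurable_int mF := I'.
    exact: (measurableT_comp mF (measurable_cons_cV (n := n))).
  move=> [x v] _; rewrite FE -EFinM /= lee_fin !normrM ler_wpM2l//.
  by rewrite ler_piMl// ler_norml cos_geN1 cos_le1.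
rewrite [LHS](@integral_pushforward _ _ _ _ R _ (measurable_cons_cV (n := n))
  (@lebesgue_measure R \x lebesgue_cV n)%E)//; last first.
  by have /measurable_int := I'.
rewrite preimage_setT.
apply: (etrans (esym (integral12_prod_meas1 IF))).
pose B := \prod_i A (lift ord0 i).
rewrite (eq_integral (fun x : measurableTypeR R => (B%:E *
  (cos (phi + \sum_i theta (lift ord0 i) + x * y ord0) * h ord0 x)%:E)%E)); last first.
  move=> x _; rewrite /fubini_F; under eq_integral do rewrite FE.
  rewrite integralZl//; last exact: (integrable_lebesgue_cV_cos _ _ Ih').
  rewrite (IH _ _ (fun i => theta (lift ord0 i)) (fun i => A (lift ord0 i)) Ih')//.
  by rewrite -!EFinM /B; congr (_%:E); rewrite (addrAC phi); ring.
rewrite integralZl//; last first.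
  apply: (le_integrable _ _ _ (Ih ord0)) => //.
    apply/measurable_EFinP; apply: measurable_funM.
      apply: measurableT_comp => /=.
        by apply: continuous_measurable_fun; exact: continuous_cos.
      by apply: measurable_funD => //; exact: measurable_funM.
    by apply/measurable_EFinP; exact: measurable_int (Ih _).
  move=> t _ /=; rewrite lee_fin normrM ler_piMl//.
  by rewrite ler_norml cos_geN1 cos_le1.
rewrite hA -EFinM !big_ord_recl /B; congr (_%:E).
by rewrite [theta ord0 + _]addrC addrA; ring.
Qed.

End product_integrals.

(** * Gaussian monomials on R^d *)

Section gaussian_cV.
Context {R : realType} {d : nat}.
Implicit Types (a phi : R) (y t : 'cV[R]_d).

Lemma dotE y t : dot t y = \sum_i t i ord0 * y i ord0.
Proof. by rewrite /dot mxE; apply: eq_bigr => i _; rewrite mxE. Qed.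

Lemma enorm_sqr t : enorm t ^+ 2 = \sum_i t i ord0 ^+ 2.
Proof.
have E : dot t t = \sum_i t i ord0 ^+ 2.
  by rewrite dotE; apply: eq_bigr => i _; rewrite expr2.
by rewrite /enorm sqr_sqrtr E// sumr_ge0// => i _; exact: sqr_ge0.
Qed.

Lemma weightE a t : weight a t = \prod_i expR (- a * t i ord0 ^+ 2).
Proof. by rewrite /weight enorm_sqr mulr_sumr expR_sum. Qed.

Definition gauss_monomial a y (k : 'I_d -> nat) t : R :=
  (\prod_i t i ord0 ^+ k i) * cos (dot t y) * weight a t.

Definition hermite_prod y (k : 'I_d -> nat) : {poly R} :=
  \prod_i gauss_hermite (y i ord0) (k i).

Lemma gauss_monomialE a y k t : gauss_monomial a y k t =
  cos (0 + \sum_i t i ord0 * y i ord0) *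
  \prod_i (t i ord0 ^+ k i * expR (- a * t i ord0 ^+ 2)).
Proof. by rewrite add0r /gauss_monomial weightE dotE big_split/=; ring. Qed.

Lemma integrable_exprn_expR a k : 0 < a ->
  lebesgue_measure.-integrable setT
    (EFin \o (fun t : R => t ^+ k * expR (- a * t ^+ 2))).
Proof.
move=> a0; have := integrable_gauss_trig k 0 0 a0; congr (integrable _ _ _).
by apply/funext => t /=; rewrite /gauss_trig mulr0 addr0 cos0 mulr1.
Qed.

Lemma integrable_gauss_monomial a y k : 0 < a ->
  (lebesgue_cV d).-integrable setT (EFin \o gauss_monomial a y k).
Proof.
move=> a0; rewrite (_ : _ \o _ = (fun t => (cos (0 + \sum_i t i ord0 * y i ord0) *
  \prod_i (t i ord0 ^+ k i * expR (- a * t i ord0 ^+ 2)))%:E)).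
  apply: (@integrable_lebesgue_cV_cos R d 0 (fun i => y i ord0)
    (fun i u => u ^+ k i * expR (- a * u ^+ 2))) => i.
  exact: integrable_exprn_expR.
by apply/funext => t /=; rewrite gauss_monomialE.
Qed.

(** The factor (a/pi)^(d/2) is the normalisation of the Gaussian weight: it cancels
    the product of the d one-dimensional masses sqrt(pi/a). *)
Lemma Rintegral_gauss_monomial a y k : 0 < a ->
  (a / pi) `^ (d%:R / 2) * \int[lebesgue_cV d]_t gauss_monomial a y k t =
  cos ((\sum_i k i)%N%:R * (pi / 2)) *
  (expR (- (enorm y ^+ 2 / 2 * (2 * a)^-1)) * (hermite_prod y k).[(2 * a)^-1]).
Proof.
move=> a0; have a_neq0 : a != 0 by rewrite gt_eqF.
have pi0 : pi != 0 :> R by rewrite gt_eqF ?pi_gt0.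
rewrite /Rintegral.
under eq_integral do rewrite gauss_monomialE.
rewrite (@integral_lebesgue_cV_cos R d (fun i => y i ord0)
  (fun i u => u ^+ k i * expR (- a * u ^+ 2)) (fun i => (k i)%:R * (pi / 2))
  (fun i => Num.sqrt (pi / a) * expR (- y i ord0 ^+ 2 / (4 * a)) *
    (gauss_hermite (y i ord0) (k i)).[(2 * a)^-1])); last 2 first.
- by move=> i; exact: integrable_exprn_expR.
- move=> i phi.
  rewrite -gauss_momentE// /gauss_moment /Rintegral fineK.
    by apply: eq_integral => u _; rewrite /gauss_trig; congr (_%:E); ring.
  apply: integrable_fin_num => //.
  exact: integrable_gauss_trig.
rewrite /= add0r !big_split/= -mulr_suml -natr_sum prodr_const card_ord.
have api0 : 0 <= a / pi by rewrite divr_ge0 ?pi_ge0// ltW.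
have -> : (a / pi) `^ (d%:R / 2) = Num.sqrt (a / pi) ^+ d.
  by rewrite [d%:R / 2]mulrC powRrM powR12_sqrt// powR_mulrn// sqrtr_ge0.
have E : Num.sqrt (a / pi) ^+ d * Num.sqrt (pi / a) ^+ d = 1.
  rewrite -exprMn -sqrtrM//.
  have -> : a / pi * (pi / a) = 1 by rewrite mulrA mulfVK // divff.
  by rewrite sqrtr1 expr1n.
have -> : \prod_i expR (- y i ord0 ^+ 2 / (4 * a)) =
    expR (- (enorm y ^+ 2 / 2 * (2 * a)^-1)).
  rewrite -expR_sum; congr expR.
  rewrite enorm_sqr !mulr_suml -sumrN; apply: eq_bigr => i _.
  by field.
rewrite /hermite_prod horner_prod.
by rewrite mulrCA; congr (_ * _); rewrite !mulrA E mul1r.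
Qed.

End gaussian_cV.

Section limits.
Context {R : realType}.

(** For c = 1/(2a), the inequality (bc)^(i+1) <= (i+1)! exp(bc) bounds c^i exp(-bc)
    by a multiple of 1/c = 2a. *)
Lemma cvg_poly_expR (b : R) (p : {poly R}) : 0 < b ->
  p.[(2 * a)^-1] * expR (- (b * (2 * a)^-1)) @[a --> 0^'+] --> (0 : R).
Proof.
move=> b0.
(* [B] collects the constants that arise monomial by monomial. *)
pose C i : R := i.+1`!%:R * b ^- i.+1.
pose B : R := \sum_(i < size p) `|p`_i| * C i.
have C0 i : 0 <= C i by rewrite mulr_ge0// invr_ge0 exprn_ge0// ltW.
have B0 : 0 <= B by apply: sumr_ge0 => i _; rewrite mulr_ge0.
apply: norm_cvg0.
apply: (@squeeze_cvgr _ _ _ _ (cst 0) (fun a => B * (2 * a))).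
- near=> a; rewrite normr_ge0/=.
  have a0 : 0 < a by near: a; exact: nbhs_right_gt.
  set c := (2 * a)^-1.
  have c0 : 0 < c by rewrite invr_gt0 mulr_gt0.
  rewrite normrM [X in _ * X <= _]ger0_norm ?expR_ge0// expRN ler_pdivrMr ?expR_gt0//.
  rewrite horner_coef (le_trans (ler_norm_sum _ _ _))// /B !mulr_suml.
  apply: ler_sum => i _; rewrite normrM -!mulrA ler_wpM2l//.
  rewrite ger0_norm ?exprn_ge0 ?(ltW c0)//.
  have -> : 2 * (a * expR (b * c)) = c^-1 * expR (b * c) by rewrite /c invrK mulrA.
  have bc : 0 <= b * c by rewrite mulr_ge0 ?ltW.
  have := exprn_le_expR i.+1 bc; rewrite exprMn => H.
  rewrite /C [leRHS]mulrCA ler_pdivlMl ?exprn_gt0// [leRHS]mulrCA.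
  by rewrite ler_pdivlMl// mulrCA -exprS.
- exact: cvg_cst.
- rewrite -[X in _ --> X](mulr0 B); apply: cvgM; first exact: cvg_cst.
  rewrite -[X in _ --> X](mulr0 2); apply: cvgM; first exact: cvg_cst.
  exact: cvg_at_right_filter.
Unshelve. all: by end_near.
Qed.

End limits.

(** * Gaussian integral of a pair of summands *)

Section has_integral.
Context {dT : measure_display} {T : measurableType dT} {R : realType}.
Variable mu : {measure set T -> \bar R}.
Implicit Types (f g : T -> R) (r s : R).

(** Integrability and value are carried together, so that finite linear
    combinations propagate both at once. *)
Definition has_integral f r : Prop :=
  mu.-integrable setT (EFin \o f) /\ (\int[mu]_t (f t)%:E = r%:E)%E.

Lemma has_integralD f g r s : has_integral f r -> has_integral g s ->
  has_integral (fun t => f t + g t) (r + s).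
Proof.
move=> [If Ef] [Ig Eg]; split.
  rewrite (_ : _ \o _ = ((EFin \o f) \+ (EFin \o g))%E)//.
  exact: integrableD.
under eq_integral do rewrite EFinD.
by rewrite integralD// Ef Eg.
Qed.

Lemma has_integralZ b f r : has_integral f r ->
  has_integral (fun t => b * f t) (b * r).
Proof.
move=> [If Ef]; split.
  rewrite (_ : _ \o _ = (fun t => (b%:E * (EFin \o f) t)%E)); last first.
    by apply/funext => t /=; rewrite EFinM.
  exact: integrableZl.
under eq_integral do rewrite EFinM.
by rewrite integralZl// Ef.
Qed.

Lemma has_integral_sum (I : Type) (s : seq I) (F : I -> T -> R) (r : I -> R) :
  (forall i, has_integral (F i) (r i)) ->
  has_integral (fun t => \sum_(i <- s) F i t) (\sum_(i <- s) r i).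
Proof.
move=> HF; split.
  rewrite (_ : _ \o _ = (fun t => (\sum_(i <- s) (F i t)%:E)%E)).
    by apply: integrable_sum => // i _; have [] := HF i.
  by apply/funext => t; rewrite sumEFin.
under eq_integral do rewrite -sumEFin.
rewrite integral_sum//; last by move=> i; have [] := HF i.
by rewrite -sumEFin; apply: eq_bigr => i _; have [] := HF i.
Qed.

End has_integral.

Section pair_integrals.
Context {R : realType} {d : nat}.
Implicit Types (a c alpha beta : R) (y t : 'cV[R]_d).

(** The exponents of the monomials t_i^2 and t_i^2 t_j^2, which make up |t|^2 and
    |t|^4. *)
Definition quad_exponent (i l : 'I_d) : nat := 2 * (l == i).
Definition quart_exponent (i j l : 'I_d) : nat :=
  quad_exponent i l + quad_exponent j l.

Lemma sum_quad_exponent i : (\sum_l quad_exponent i l)%N = 2%N.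
Proof.
rewrite (bigD1 i)//= /quad_exponent eqxx big1 => [//|l /negPf ->].
by rewrite muln0.
Qed.

Lemma prod_quad_exponent (x : 'I_d -> R) i :
  \prod_l x l ^+ quad_exponent i l = x i ^+ 2.
Proof.
rewrite (bigD1 i)//= /quad_exponent eqxx muln1 big1 ?mulr1// => l /negPf ->.
by rewrite muln0 expr0.
Qed.

Definition pair_integrand a alpha beta y t : R :=
  (enorm t ^+ 2 + alpha) * (enorm t ^+ 2 + beta) * cos (dot t y) * weight a t.

(** The sign of the middle term is cos(pi): a monomial of degree 2 shifts the phase
    by [pi], while those of degree 0 and 4 leave it unchanged modulo [2 * pi]. *)
Definition pair_poly alpha beta y : {poly R} :=
  \sum_i \sum_j hermite_prod y (quart_exponent i j)
  - (alpha + beta) *: (\sum_i hermite_prod y (quad_exponent i))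
  + (alpha * beta)%:P.

Lemma pair_integrandE a alpha beta y t : pair_integrand a alpha beta y t =
  \sum_i \sum_j gauss_monomial a y (quart_exponent i j) t
  + (alpha + beta) * \sum_i gauss_monomial a y (quad_exponent i) t
  + alpha * beta * gauss_monomial a y (fun=> 0%N) t.
Proof.
pose K := cos (dot t y) * weight a t.
have E0 : gauss_monomial a y (fun=> 0%N) t = K.
  by rewrite /gauss_monomial big1 ?mul1r// => i _; rewrite expr0.
have E2 : \sum_i gauss_monomial a y (quad_exponent i) t = enorm t ^+ 2 * K.
  rewrite enorm_sqr mulr_suml; apply: eq_bigr => i _.
  by rewrite /gauss_monomial (prod_quad_exponent (fun l => t l ord0)) -mulrA.
have E4 : \sum_i \sum_j gauss_monomial a y (quart_exponent i j) t =
    enorm t ^+ 2 * (enorm t ^+ 2 * K).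
  rewrite {1}enorm_sqr mulr_suml; apply: eq_bigr => i _.
  rewrite enorm_sqr mulr_suml mulr_sumr; apply: eq_bigr => j _.
  rewrite /gauss_monomial -mulrA -/K mulrA; congr (_ * _).
  under eq_bigr do rewrite /quart_exponent exprD.
  by rewrite big_split/= !(prod_quad_exponent (fun l => t l ord0)).
by rewrite E0 E2 E4 /pair_integrand -mulrA -/K; ring.
Qed.

Lemma has_integral_pair a alpha beta y : 0 < a ->
  has_integral (lebesgue_cV d) (pair_integrand a alpha beta y)
   (((a / pi) `^ (d%:R / 2))^-1 *
    (expR (- (enorm y ^+ 2 / 2 * (2 * a)^-1)) *
     (pair_poly alpha beta y).[(2 * a)^-1])).
Proof.
move=> a0; set A := _ `^ _; set E := expR _; set c := (2 * a)^-1.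
have A0 : A != 0 by rewrite gt_eqF// powR_gt0// divr_gt0// pi_gt0.
have M k : has_integral (lebesgue_cV d) (gauss_monomial a y k)
    (A^-1 * (cos ((\sum_i k i)%N%:R * (pi / 2)) * (E * (hermite_prod y k).[c]))).
  have I := integrable_gauss_monomial y k a0; split=> //.
  rewrite -Rintegral_gauss_monomial// mulKf// /Rintegral fineK//.
  exact: integrable_fin_num.
rewrite (_ : pair_integrand _ _ _ _ = fun t => pair_integrand a alpha beta y t)//.
under eq_fun do rewrite pair_integrandE.
have H4 i j : has_integral (lebesgue_cV d) (gauss_monomial a y (quart_exponent i j))
    (A^-1 * (E * (hermite_prod y (quart_exponent i j)).[c])).
  have := M (quart_exponent i j).
  rewrite big_split/= !sum_quad_exponent (_ : _ * (pi / 2) = pi *+ 2).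
    by rewrite cos2pi mul1r.
  by rewrite -mulr_natl natrD; field.
have H2 i : has_integral (lebesgue_cV d) (gauss_monomial a y (quad_exponent i))
    (A^-1 * (- (E * (hermite_prod y (quad_exponent i)).[c]))).
  have := M (quad_exponent i).
  rewrite sum_quad_exponent (_ : 2%:R * (pi / 2) = pi); last by field.
  by rewrite cospi mulN1r.
have H0 : has_integral (lebesgue_cV d) (gauss_monomial a y (fun=> 0%N)) (A^-1 * E).
  have := M (fun=> 0%N); rewrite big1// mul0r cos0 mul1r.
  by rewrite /hermite_prod big1// hornerC mulr1.
have := has_integralD (has_integralD
   (has_integral_sum (index_enum 'I_d) (fun i =>
      has_integral_sum (index_enum 'I_d) (H4 i)))
   (has_integralZ (alpha + beta) (has_integral_sum (index_enum 'I_d) H2)))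
   (has_integralZ (alpha * beta) H0).
congr has_integral.
have S4 : \sum_i \sum_j A^-1 * (E * (hermite_prod y (quart_exponent i j)).[c]) =
    A^-1 * (E * (\sum_i \sum_j hermite_prod y (quart_exponent i j)).[c]).
  rewrite horner_sum !mulr_sumr; apply: eq_bigr => i _.
  by rewrite horner_sum !mulr_sumr.
have S2 : \sum_i A^-1 * - (E * (hermite_prod y (quad_exponent i)).[c]) =
    A^-1 * - (E * (\sum_i hermite_prod y (quad_exponent i)).[c]).
  by rewrite horner_sum -mulr_sumr sumrN -mulr_sumr.
by rewrite S4 S2 /pair_poly !hornerD hornerN hornerZ hornerC; ring.
Qed.

Lemma gauss_hermite0_2 : @gauss_hermite R 0 2 = - 'X.
Proof. by rewrite gauss_hermiteS scale0r sub0r scale1r mulrN mulr1. Qed.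

Lemma gauss_hermite0_4 : @gauss_hermite R 0 4 = 3 *: 'X^2.
Proof.
rewrite gauss_hermiteS [4.-2.+1.-1]/= gauss_hermite0_2 scale0r sub0r.
by rewrite scalerN opprK -scalerAr.
Qed.

Lemma hermite_prod0_quad i : hermite_prod (0 : 'cV[R]_d) (quad_exponent i) = - 'X.
Proof.
rewrite /hermite_prod (bigD1 i)//= /quad_exponent eqxx muln1 mxE.
rewrite gauss_hermite0_2 big1 ?mulr1// => l /negPf ->.
by rewrite muln0.
Qed.

(** Up to scaling, these are the moments of independent centred normal variables:
    the fourth moment is 3 times the square of the second. *)
Lemma hermite_prod0_quart i j :
  hermite_prod (0 : 'cV[R]_d) (quart_exponent i j) = (1 + 2 * (i == j)%:R) *: 'X^2.
Proof.
rewrite /hermite_prod /quart_exponent /quad_exponent.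
have [<-|ij] := eqVneq i j.
  rewrite (bigD1 i)//= eqxx muln1 mxE gauss_hermite0_4 big1 ?mulr1 => [|l /negPf ->].
    by congr (_ *: _); ring.
  by rewrite muln0.
rewrite (bigD1 i)//= (bigD1 j)/= 1?eq_sym// !eqxx ?[j == i]eq_sym (negPf ij).
rewrite !muln1 !muln0 addn0 add0n !mxE gauss_hermite0_2 big1 ?mulr1.
  by rewrite mulrNN mulr0 addr0 scale1r expr2.
by move=> l /andP[/negPf -> /negPf ->]; rewrite muln0.
Qed.

(** The coefficient d(d+2) is d^2 + 2d: there are d^2 pairs (i, j), and each of the
    d diagonal ones counts for 3 instead of 1. *)
Lemma pair_poly0 alpha beta c : (pair_poly alpha beta 0).[c] =
  d%:R * (d%:R + 2) * c ^+ 2 + (alpha + beta) * d%:R * c + alpha * beta.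
Proof.
have S2 : \sum_i hermite_prod (0 : 'cV[R]_d) (quad_exponent i) = d%:R *: - 'X.
  under eq_bigr do rewrite hermite_prod0_quad.
  by rewrite sumr_const card_ord scaler_nat.
have S4 : \sum_i \sum_j hermite_prod (0 : 'cV[R]_d) (quart_exponent i j) =
    (d%:R * (d%:R + 2)) *: 'X^2.
  rewrite (eq_bigr (fun=> (d%:R + 2) *: 'X^2)) => [|i _].
    by rewrite sumr_const card_ord -scaler_nat scalerA.
  under eq_bigr do rewrite hermite_prod0_quart.
  rewrite -scaler_suml big_split/= sumr_const card_ord -mulr_sumr; congr ((_ + _) *: _).
  rewrite (bigD1 i)//= eqxx big1 ?addr0 ?mulr1// => j /negPf.
  by rewrite eq_sym => ->.
by rewrite /pair_poly S2 S4 !hornerD hornerN !hornerZ hornerC hornerN hornerXn hornerX; ring.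
Qed.

End pair_integrals.

(** * Laplacian and modulus of trigonometric sums *)

Section trigonometric_sums.
Context {R : realType} {d n : nat}.
Implicit Types (phi : R) (t v y : 'cV[R]_d) (b : 'I_n -> R) (Y : 'I_n -> 'cV[R]_d).

Lemma dotDl y t v : dot (t + v) y = dot t y + dot v y.
Proof. by rewrite /dot linearD mulmxDl mxE. Qed.

Lemma dotZl y (c : R) t : dot (c *: t) y = c * dot t y.
Proof. by rewrite /dot linearZ /= -scalemxAl mxE. Qed.

Lemma dotNl y t : dot (- t) y = - dot t y.
Proof. by rewrite -scaleN1r dotZl mulN1r. Qed.

Lemma dotC t y : dot t y = dot y t.
Proof. by rewrite !dotE; apply: eq_bigr => i _; rewrite mulrC. Qed.

Lemma dot_delta y k : dot (delta_mx k ord0) y = y k ord0.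
Proof.
rewrite dotE (bigD1 k)//= mxE !eqxx mul1r big1 ?addr0// => i /negPf ik.
by rewrite mxE ik mul0r.
Qed.

(** Reduces a directional derivative to a derivative on the line. *)
Lemma is_derive_line (V : normedModType R) (f : V -> R) (x v : V) (g : R -> R) (c : R) :
  (forall h, f (h *: v + x) = g h) -> is_derive (0 : R) (1 : R) g c -> is_derive x v f c.
Proof.
move=> fg [dg Dg].
have E : (fun h => h^-1 *: ((f \o shift x) (h *: v) - f x)) =
         (fun h => h^-1 *: ((g \o shift 0) (h *: 1) - g 0)).
  apply/funext => h /=; rewrite fg addr0 [h *: 1]mulr1.
  by rewrite -(fg 0) scale0r add0r.
by split; [rewrite /derivable E|rewrite /derive E].
Qed.

Lemma is_derive_cos_dot phi y t v :
  is_derive t v (fun s => cos (phi + dot s y))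
    (dot v y * cos (phi + pi / 2 + dot t y)).
Proof.
apply: (@is_derive_line _ _ t v
  (fun h => cos (phi + dot t y + h * dot v y))) => [h|].
  by rewrite dotDl dotZl addrAC addrA.
have := @is_derive1_comp R cos _ 0 _ _ (is_derive_cos _)
  (is_derive_affine (phi + dot t y) (dot v y) 0).
move=> /is_derive_eq; apply; rewrite mul0r addr0 mulrC.
by rewrite addrAC cosDpihalf.
Qed.

(** Real coefficients and a common phase are stable under partial derivatives, and
    the real and imaginary parts stay explicit. *)
Definition trig_sum b Y phi t : R[i] :=
  \sum_j (b j)%:C%C * cexpi (phi + dot t (Y j)).

Lemma Re_trig_sum b Y phi t :
  complex.Re (trig_sum b Y phi t) = \sum_j b j * cos (phi + dot t (Y j)).
Proof.
rewrite /trig_sum raddf_sum; apply: eq_bigr => j _.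
by rewrite /cexpi; simpc.
Qed.

Lemma Im_trig_sum b Y phi t :
  complex.Im (trig_sum b Y phi t) = \sum_j b j * sin (phi + dot t (Y j)).
Proof.
rewrite /trig_sum raddf_sum; apply: eq_bigr => j _.
by rewrite /cexpi; simpc.
Qed.

Lemma derive_cos_sum b Y phi t k :
  'D_(delta_mx k ord0) (fun s => \sum_j b j * cos (phi + dot s (Y j))) t =
  \sum_j b j * Y j k ord0 * cos (phi + pi / 2 + dot t (Y j)).
Proof.
have D j : is_derive t (delta_mx k ord0 : 'cV[R]_d)
    (fun s => b j * cos (phi + dot s (Y j)))
    (b j * Y j k ord0 * cos (phi + pi / 2 + dot t (Y j))).
  have := is_deriveZ (b j) (is_derive_cos_dot phi (Y j) t (delta_mx k ord0)).
  by move=> /is_derive_eq; apply; rewrite dot_delta /GRing.scale/= mulrA.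
have := is_derive_sum D.
rewrite (_ : (\sum_j _) = (fun s => \sum_j b j * cos (phi + dot s (Y j)))); last first.
  by apply/funext => s; rewrite fct_sumE.
by case.
Qed.

Lemma cpartial_trig_sum b Y phi k :
  cpartial k (trig_sum b Y phi) =
  trig_sum (fun j => b j * Y j k ord0) Y (phi + pi / 2).
Proof.
apply/funext => t; apply/eqP; rewrite eq_complex Re_trig_sum Im_trig_sum /=.
apply/andP; split; apply/eqP.
  under eq_fun do rewrite Re_trig_sum.
  exact: derive_cos_sum.
have sinE (u : R) : sin u = cos (u - pi / 2).
  by rewrite cosB cos_pihalf sin_pihalf mulr0 add0r mulr1.
under eq_fun => s.
  rewrite Im_trig_sum; under eq_bigr do rewrite sinE addrAC.
  over.
rewrite derive_cos_sum; apply: eq_bigr => j _.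
by rewrite sinE; congr (_ * cos _); ring.
Qed.

(** Two derivatives shift the phase by [pi], hence change the sign. *)
Lemma laplacian_trig_sum b Y t :
  laplacian (trig_sum b Y 0) t =
  - trig_sum (fun j => b j * enorm (Y j) ^+ 2) Y 0 t.
Proof.
rewrite /laplacian.
under eq_bigr do rewrite !cpartial_trig_sum.
rewrite /trig_sum exchange_big -sumrN; apply: eq_bigr => j _ /=.
have -> : cexpi (0 + pi / 2 + pi / 2 + dot t (Y j)) = - cexpi (0 + dot t (Y j)).
  rewrite (_ : 0 + pi / 2 + pi / 2 + dot t (Y j) = dot t (Y j) + pi); last by field.
  by rewrite /cexpi cosDpi sinDpi add0r; simpc.
rewrite -mulr_suml mulrN; congr (- (_ * _)).
rewrite enorm_sqr mulr_sumr rmorph_sum; apply: eq_bigr => k _.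
by rewrite -mulrA -expr2.
Qed.

Lemma normc_trig_sum_sqr b Y t :
  ComplexField.Normc.normc (trig_sum b Y 0 t) ^+ 2 =
  \sum_j \sum_k b j * b k * cos (dot t (Y j - Y k)).
Proof.
rewrite /ComplexField.Normc.normc.
case E : (trig_sum b Y 0 t) => [u w].
have := Re_trig_sum b Y 0 t; have := Im_trig_sum b Y 0 t; rewrite E /= => -> ->.
rewrite sqr_sqrtr ?addr_ge0 ?sqr_ge0// !expr2 !mulr_suml -big_split/=.
apply: eq_bigr => j _; rewrite !mulr_sumr -big_split/=; apply: eq_bigr => k _.
rewrite [dot t (Y j - Y k)]dotC dotDl dotNl ![dot _ t]dotC cosB !add0r.
by ring.
Qed.

End trigonometric_sums.

(** * Expansion and limit of the statistic *)

Lemma cvg_sum0 (R : realType) (I T : Type) (F : set_system T) (FF : Filter F)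
    (s : seq I) (P : pred I) (f : I -> T -> R) :
  (forall i, P i -> f i x @[x --> F] --> (0 : R)) ->
  \sum_(i <- s | P i) f i x @[x --> F] --> (0 : R).
Proof.
move=> f0; elim: s => [|i s IH].
  by under eq_fun do rewrite big_nil; exact: cvg_cst.
under eq_fun do rewrite big_cons.
case Pi: (P i) => //.
have := cvgD (f0 _ Pi) IH; rewrite addr0; exact.
Qed.

Section expansion.
Context {R : realType} {d n : nat}.
Variable x : 'I_n -> 'cV[R]_d.
Hypothesis n_gt0 : (0 < n)%N.
Let Y := residual x.
Let alpha j : R := enorm (Y j) ^+ 2 - d%:R.

Let n_neq0 : n%:R != 0 :> R. Proof. by rewrite pnatr_eq0 -lt0n. Qed.

Lemma psi_trig_sum : psi x = trig_sum (fun=> n%:R^-1) Y 0.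
Proof.
apply/funext => t; rewrite /psi /trig_sum mulr_sumr; apply: eq_bigr => j _.
by rewrite add0r (fmorphV (real_complex R)) rmorph_nat.
Qed.

Lemma statU_integrand t :
  laplacian (psi x) t - (enorm t ^+ 2 - d%:R)%:C%C * psi x t =
  trig_sum (fun j => - n%:R^-1 * (enorm t ^+ 2 + alpha j)) Y 0 t.
Proof.
rewrite psi_trig_sum laplacian_trig_sum /trig_sum mulr_sumr -!sumrN -big_split/=.
apply: eq_bigr => j _; rewrite mulrA -rmorphM -!mulNr -mulrDl -!rmorphN -rmorphD.
by congr (_%:C%C * _); rewrite /alpha; ring.
Qed.

Lemma statUE a : 0 < a ->
  statU x a = (((a / pi) `^ (d%:R / 2))^-1 * n%:R^-1 *
    \sum_j \sum_k expR (- (enorm (Y j - Y k) ^+ 2 / 2 * (2 * a)^-1)) *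
      (pair_poly (alpha j) (alpha k) (Y j - Y k)).[(2 * a)^-1])%:E.
Proof.
move=> a0; rewrite /statU; set A := _ `^ _.
have H := has_integralZ (n%:R^-1 ^+ 2) (has_integral_sum (index_enum 'I_n) (fun j =>
  has_integral_sum (index_enum 'I_n) (fun k =>
    has_integral_pair (alpha j) (alpha k) (Y j - Y k) a0))).
have [_] := H; rewrite -/A => E.
transitivity (n%:R%:E * (\int[lebesgue_cV d]_t (n%:R^-1 ^+ 2 *
    \sum_j \sum_k pair_integrand a (alpha j) (alpha k) (Y j - Y k) t)%:E))%E.
  congr (_ * _)%E; apply: eq_integral => t _.
  rewrite statU_integrand normc_trig_sum_sqr; congr (_%:E).
  rewrite mulr_suml mulr_sumr; apply: eq_bigr => j _.
  rewrite mulr_suml mulr_sumr; apply: eq_bigr => k _.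
  by rewrite /pair_integrand; ring.
rewrite E -EFinM; congr (_%:E).
under eq_bigr do rewrite -mulr_sumr.
rewrite -mulr_sumr; field.
by rewrite n_neq0 gt_eqF// powR_gt0// divr_gt0// pi_gt0.
Qed.

(** The diagonal terms give the limit together with the subtracted singular term;
    each off-diagonal term has a nonzero frequency and tends to 0. *)
Lemma statU_cvg : injective Y -> \sum_j enorm (Y j) ^+ 2 = n%:R * d%:R ->
  (fun a : R => ((a / pi) `^ (d%:R / 2))%:E * statU x a
                - (d%:R * (d%:R + 2) / (4 * a ^+ 2))%:E)%E @ 0^'+
  --> (n%:R^-1 * (\sum_(j < n) enorm (Y j) ^+ 4) - d%:R ^+ 2)%:E.
Proof.
move=> Yinj sumY.
pose F j k a := (pair_poly (alpha j) (alpha k) (Y j - Y k)).[(2 * a)^-1] *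
  expR (- (enorm (Y j - Y k) ^+ 2 / 2 * (2 * a)^-1)).
pose L := n%:R^-1 * (\sum_(j < n) enorm (Y j) ^+ 4) - d%:R ^+ 2.
have sum_alpha : \sum_j alpha j = 0.
  by rewrite sumrB sumY sumr_const card_ord -[d%:R *+ n]mulr_natl subrr.
have sum_alpha2 : n%:R^-1 * \sum_j alpha j ^+ 2 = L.
  have -> : \sum_j alpha j ^+ 2 =
      \sum_j enorm (Y j) ^+ 4 - 2 * d%:R * \sum_j enorm (Y j) ^+ 2 + n%:R * d%:R ^+ 2.
    have -> : n%:R * d%:R ^+ 2 = \sum_(j < n) d%:R ^+ 2 :> R.
      by rewrite sumr_const card_ord mulr_natl.
    rewrite mulr_sumr -sumrB -big_split/=.
    by apply: eq_bigr => j _; rewrite /alpha; ring.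
  by rewrite sumY /L; field.
have diag j a : F j j a = d%:R * (d%:R + 2) * (2 * a)^-1 ^+ 2 +
    2 * d%:R * (2 * a)^-1 * alpha j + alpha j ^+ 2.
  rewrite /F subrr pair_poly0 enorm_sqr big1 => [|i _]; last by rewrite mxE expr0n.
  by rewrite !mul0r oppr0 expR0 mulr1; ring.
have cvgF j k : k != j -> F j k a @[a --> 0^'+] --> 0.
  move=> kj; apply: cvg_poly_expR.
  rewrite divr_gt0// lt_neqAle sqr_ge0 andbT eq_sym.
  apply: contra kj => /eqP; rewrite enorm_sqr => /eqP.
  rewrite psumr_eq0 => [/allP Y0|i _]; last exact: sqr_ge0.
  rewrite eq_sym -(inj_eq Yinj) -subr_eq0; apply/eqP/matrixP => i l.
  rewrite ord1 [RHS]mxE; apply/eqP; rewrite -sqrf_eq0.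
  by have := Y0 i (mem_index_enum i).
pose G a := L + n%:R^-1 * \sum_j \sum_(k | k != j) F j k a.
have cvgG : G a @[a --> 0^'+] --> L.
  rewrite -[X in _ --> X]addr0; apply: cvgD; first exact: cvg_cst.
  rewrite -[X in _ --> X](mulr0 n%:R^-1); apply: cvgM; first exact: cvg_cst.
  apply: cvg_sum0 => j _; apply: cvg_sum0 => k kj; exact: cvgF.
have cvgGE : (EFin \o G) a @[a --> 0^'+] --> L%:E.
  by apply: cvg_EFin; [exact: nearW|exact: cvgG].
apply: cvg_trans cvgGE; apply: near_eq_cvg; near=> a.
have a0 : 0 < a by near: a; exact: nbhs_right_gt.
have A0 : (a / pi) `^ (d%:R / 2) != 0.
  by rewrite gt_eqF// powR_gt0// divr_gt0// pi_gt0.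
rewrite statUE// -EFinM -EFinB /=; congr (_%:E).
rewrite !mulrA mulfV// mul1r /G.
have diag_sum : \sum_j F j j a =
    n%:R * (d%:R * (d%:R + 2) * (2 * a)^-1 ^+ 2) + n%:R * L.
  rewrite (eq_bigr _ (fun j _ => diag j a)) !big_split/= sumr_const card_ord.
  rewrite -mulr_sumr sum_alpha mulr0 addr0 -[_ *+ n in LHS]mulr_natl.
  by rewrite -sum_alpha2 mulVKf.
have -> : \sum_j \sum_k expR (- (enorm (Y j - Y k) ^+ 2 / 2 * (2 * a)^-1)) *
      (pair_poly (alpha j) (alpha k) (Y j - Y k)).[(2 * a)^-1] =
    n%:R * (d%:R * (d%:R + 2) * (2 * a)^-1 ^+ 2) + n%:R * L
    + \sum_j \sum_(k | k != j) F j k a.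
  rewrite -diag_sum -big_split/=; apply: eq_bigr => j _.
  rewrite (bigD1 j)//=; congr (_ + _); first by rewrite /F mulrC.
  by apply: eq_bigr => k _; rewrite /F mulrC.
by field; rewrite gt_eqF.
Unshelve. all: by end_near.
Qed.

End expansion.

(** * Square root of a positive definite matrix *)

Section square_roots.
Context {R : realType}.

Lemma interpolation (F : fieldType) (f : F -> F) (s : seq F) :
  exists p : {poly F}, forall z, z \in s -> p.[z] = f z.
Proof.
elim: s => [|w s [p pf]]; first by exists 0.
have [ws|ws] := boolP (w \in s).
  by exists p => z; rewrite inE => /predU1P[->|]; exact: pf.
pose q : {poly F} := \prod_(z <- s) ('X - z%:P).
have qw : q.[w] != 0 by rewrite -[_ == _]/(root q w) root_prod_XsubC.
exists (p + ((f w - p.[w]) / q.[w]) *: q) => z; rewrite inE hornerD hornerZ.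
case/predU1P => [->|zs]; first by rewrite divfK// addrC subrK.
have /eqP -> : root q z by rewrite root_prod_XsubC.
by rewrite mulr0 addr0 pf.
Qed.

Lemma dot_mulmx n (x y : 'cV[R]_n) (A : 'M[R]_n) : dot (A *m x) y = dot x (A^T *m y).
Proof. by rewrite /dot trmx_mul mulmxA. Qed.

Lemma dot_ge0 n (x : 'cV[R]_n) : 0 <= dot x x.
Proof. by rewrite dotE sumr_ge0// => i _; rewrite -expr2 sqr_ge0. Qed.

Lemma dot_eq0 n (x : 'cV[R]_n) : (dot x x == 0) = (x == 0).
Proof.
apply/eqP/eqP => [|->]; last by rewrite dotE big1// => i _; rewrite mxE mul0r.
move=> /eqP; rewrite dotE psumr_eq0 => [/allP x0|i _]; last by rewrite -expr2 sqr_ge0.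
apply/matrixP => i j; rewrite ord1 mxE; apply/eqP.
by have := x0 i (mem_index_enum i); rewrite /= mulf_eq0 orbb.
Qed.

Lemma horner_mx_sym n (A : 'M[R]_n.+1) p : A^T = A -> (horner_mx A p)^T = horner_mx A p.
Proof.
move=> As; elim/poly_ind: p => [|p c IH]; first by rewrite !rmorph0 trmx0.
rewrite rmorphD rmorphM/= horner_mx_X horner_mx_C linearD/= tr_scalar_mx.
rewrite -[_ * A]/(_ *m A) trmx_mul IH As; congr (_ + _).
exact: comm_mx_horner.
Qed.

Lemma posdef_eigenvalue_gt0 n (A : 'M[R]_n) r : posdef A -> eigenvalue A r -> 0 < r.
Proof.
move=> [As Apos] /eigenvalueP[v vA v0].
have vT0 : v^T != 0 by rewrite trmx_eq0.
have := Apos _ vT0; have -> : A *m v^T = r *: v^T.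
  by rewrite -[A in LHS]As -trmx_mul vA linearZ.
rewrite dotC dotZl; have := dot_ge0 v^T.
rewrite le_eqVlt eq_sym dot_eq0 (negPf vT0)/= => vv.
by rewrite pmulr_lgt0.
Qed.

Lemma horner_mx_diagonalized (F : fieldType) n (P : 'M[F]_n.+1)
    (D : 'rV[F]_n.+1) (q : {poly F}) :
  P \in unitmx -> (forall i, q.[D 0 i] = D 0 i) ->
  horner_mx (invmx P *m diag_mx D *m P) q = invmx P *m diag_mx D *m P.
Proof.
move=> Pu qD; rewrite horner_mx_uconjC// horner_mx_diag.
by congr (_ *m diag_mx _ *m _); apply/rowP => i; rewrite mxE qD.
Qed.

(** The spectral theorem is only used through this consequence: a polynomial that
    fixes the eigenvalues of a symmetric real matrix fixes the matrix.  The
    diagonalisation takes place over the complex numbers, where the eigenvalues are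
    found to be real, and the conclusion descends to the real matrix by injectivity
    of scalar extension. *)
Lemma symmetric_spectrum n (A : 'M[R]_n.+1) : A^T = A -> exists s : seq R,
  (forall r, r \in s -> eigenvalue A r) /\
  forall q : {poly R}, (forall r, r \in s -> q.[r] = r) -> horner_mx A q = A.
Proof.
move=> As; pose f := real_complex R.
pose Ac := map_mx f A.
have Acsym : Ac \is symmetricmx.
  apply/is_hermitianmxP; rewrite expr0 scale1r map_mx_id//.
  by rewrite /Ac map_trmx As.
have Acreal : Ac \is a realmx.
  by apply/mxOverP => i j; rewrite mxE complex_real.
have Aherm := realsym_hermsym Acsym Acreal.
have [P [D [Pu Aspec Dreal]]] : exists (P : 'M[R[i]]_n.+1) (D : 'rV[R[i]]_n.+1),
    [/\ P \in unitmx, Ac = invmx P *m diag_mx D *m P & D \is a realmx].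
  exists (spectralmx Ac), (spectral_diag Ac).
  split; [exact: spectral_unit|exact/orthomx_spectralP/hermitian_normalmx|].
  exact: hermitian_spectral_diag_real.
pose r i : R := complex.Re (D 0 i).
have Dr i : D 0 i = f (r i).
  by rewrite /r /f /= RRe_real//; exact: (mxOverP Dreal).
exists [seq r i | i <- enum 'I_n.+1]; split.
  move=> _ /mapP[i _ ->]; suff : eigenvalue Ac (D 0 i) by rewrite Dr eigenvalue_map.
  apply/eigenvalueP; exists (row i P).
    rewrite -row_mul -/Ac Aspec !mulmxA mulmxV// mul1mx.
    by rewrite row_mul row_diag_mx -scalemxAl -rowE.
  apply/eqP; rewrite rowE => /(congr1 (mulmx^~ (invmx P))).
  rewrite -mulmxA mulmxV// mulmx1 mul0mx => /matrixP/(_ 0 i)/eqP.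
  by rewrite !mxE !eqxx oner_eq0.
move=> q qr; apply: (@map_mx_inj _ _ f).
rewrite map_horner_mx -/Ac Aspec horner_mx_diagonalized// => i.
by rewrite Dr horner_map qr//; apply: map_f; rewrite mem_enum.
Qed.

(** Let B be a polynomial in A that takes the value r^(1/4) at each eigenvalue r.
    Then B is symmetric and B^4 = A, so B^2 is a square root of A.  Fourth roots are
    used instead of square roots because x.(B^2 x) = |Bx|^2 then shows positivity
    directly. *)
Lemma posdef_sqrt n (A : 'M[R]_n) : posdef A ->
  exists Q : 'M[R]_n, posdef Q /\ Q *m Q = A.
Proof.
case: n A => [|n] A Apd.
  by exists A; split=> //; apply/matrixP => -[].
have [s [sA qA]] := symmetric_spectrum Apd.1.
have [p ps] := interpolation (fun r => Num.sqrt (Num.sqrt r)) s.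
pose B := horner_mx A p.
have BT : B^T = B by apply: horner_mx_sym; exact: Apd.1.
have B4 : (B *m B) *m (B *m B) = A.
  rewrite -[RHS](qA (p ^+ 4)) => [|r rs].
    by rewrite rmorphXn/= -/B !exprS expr0 mulr1 -mulmxA.
  have r0 := posdef_eigenvalue_gt0 Apd (sA _ rs).
  rewrite horner_exp ps// (exprM _ 2 2) sqr_sqrtr ?sqrtr_ge0// sqr_sqrtr//.
  exact: ltW.
exists (B *m B); split=> //; split; first by rewrite trmx_mul BT.
move=> x x0; rewrite -mulmxA -{1}BT -dot_mulmx.
rewrite lt_neqAle dot_ge0 andbT eq_sym dot_eq0; apply: contraTneq (Apd.2 x x0).
by move=> Bx; rewrite -B4 -!mulmxA Bx !mulmx0 dotE big1 ?ltxx// => i _; rewrite mxE mulr0.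
Qed.

Lemma sqrtmxP n (A : 'M[R]_n) : posdef A ->
  posdef (sqrtmx A) /\ sqrtmx A *m sqrtmx A = A.
Proof. by move=> /posdef_sqrt; exact: xgetPex. Qed.

End square_roots.

(** * Standardisation by the sample covariance *)

Section residuals.
Context {R : realType} {d n : nat}.
Variable x : 'I_n -> 'cV[R]_d.
Hypothesis n_gt0 : (0 < n)%N.
Let z j := x j - sample_mean x.
Let S := sample_cov x.

Let nV_gt0 : 0 < n%:R^-1 :> R. Proof. by rewrite invr_gt0 ltr0n. Qed.

Lemma sample_cov_sym : S^T = S.
Proof.
rewrite /S /sample_cov linearZ linear_sum /=; congr (_ *: _).
by apply: eq_bigr => j _; rewrite trmx_mul trmxK.
Qed.

Lemma sample_cov_mulmx (u : 'cV[R]_d) :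
  S *m u = n%:R^-1 *: \sum_j dot (z j) u *: z j.
Proof.
rewrite /S /sample_cov -scalemxAl mulmx_suml; congr (_ *: _).
apply: eq_bigr => j _; rewrite -mulmxA -/(z j) -mul_mx_scalar; congr (_ *m _).
by apply/matrixP => k l; rewrite !ord1 [RHS]mxE eqxx mulr1n.
Qed.

Lemma dot_sample_cov (u : 'cV[R]_d) :
  dot u (S *m u) = n%:R^-1 * \sum_j dot (z j) u ^+ 2.
Proof.
rewrite dotC sample_cov_mulmx dotZl; congr (_ * _).
rewrite /dot linear_sum mulmx_suml summxE; apply: eq_bigr => j _.
by rewrite -[LHS]/(dot (dot (z j) u *: z j) u) dotZl expr2.
Qed.

Lemma sample_cov_posdef : S \in unitmx -> posdef S.
Proof.
move=> Su; split; first exact: sample_cov_sym.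
move=> u u0.
rewrite dot_sample_cov mulr_gt0// lt_neqAle sumr_ge0 ?andbT => [|j _]; last exact: sqr_ge0.
apply: contra_neq u0 => /esym/eqP.
rewrite psumr_eq0 => [/allP z0|j _]; last exact: sqr_ge0.
rewrite -[u](mulKmx Su) sample_cov_mulmx big1 ?scaler0 ?mulmx0// => j _.
by have := z0 j (mem_index_enum j); rewrite /= sqrf_eq0 => /eqP ->; rewrite scale0r.
Qed.

Lemma posdef_invmx (A : 'M[R]_d) : A \in unitmx -> posdef A -> posdef (invmx A).
Proof.
move=> Au [As Apos]; split; first by rewrite trmx_inv As.
move=> u u0; set w := invmx A *m u.
have uE : u = A *m w by rewrite mulKVmx.
rewrite uE dotC Apos//; apply: contra_neq u0 => w0.
by rewrite uE w0 mulmx0.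
Qed.

Lemma residual_inj : injective x -> S \in unitmx -> injective (residual x).
Proof.
move=> xinj Su; have [_ QQ] := sqrtmxP (posdef_invmx Su (sample_cov_posdef Su)).
have Qu : sqrtmx (invmx S) \in unitmx.
  have : sqrtmx (invmx S) *m sqrtmx (invmx S) \in unitmx by rewrite QQ unitmx_inv.
  by rewrite unitmx_mul => /andP[].
move=> i j; rewrite /residual => /(congr1 (mulmx (invmx (sqrtmx (invmx S))))).
by rewrite !mulKmx// => /addIr/xinj.
Qed.

(** With Q^2 = S^-1, the empirical covariance of the residuals is Q S Q, and the
    trace of n Q S Q is n tr(Q Q S) = n d. *)
Lemma sum_residual_sqr : S \in unitmx ->
  \sum_j enorm (residual x j) ^+ 2 = n%:R * d%:R.
Proof.
move=> Su; have [[QT _] QQ] := sqrtmxP (posdef_invmx Su (sample_cov_posdef Su)).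
set Q := sqrtmx _ in QT QQ.
have nR : n%:R != 0 :> R by rewrite pnatr_eq0 -lt0n.
have sumE : \sum_j z j *m (z j)^T = n%:R *: S.
  by rewrite /S /sample_cov scalerA divff// scale1r.
transitivity (\tr (\sum_j residual x j *m (residual x j)^T)).
  rewrite linear_sum; apply: eq_bigr => j _ /=.
  rewrite mxtrace_mulC /mxtrace big_ord1 -[RHS]/(dot _ _).
  by rewrite /enorm sqr_sqrtr// dot_ge0.
have -> : \sum_j residual x j *m (residual x j)^T = n%:R *: (Q *m S *m Q).
  rewrite scalemxAl scalemxAr -sumE mulmx_sumr mulmx_suml.
  by apply: eq_bigr => j _; rewrite /residual -/Q trmx_mul QT !mulmxA.
by rewrite mxtraceZ mxtrace_mulC mulmxA QQ mulVmx// mxtrace1.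
Qed.

End residuals.

(** * Resampling one coordinate of an independent family *)

Section boxes.
Context {dE : measure_display} {E : measurableType dE} {n : nat}.

Definition box (B : 'I_n -> set E) : set 'cV[E]_n :=
  [set v | forall i, B i (v i ord0)].

Lemma measurable_box B : (forall i, measurable (B i)) -> measurable (box B).
Proof.
move=> mB; rewrite (_ : box B = \bigcap_i [set v : 'cV[E]_n | B i (v i ord0)]).
  apply: fin_bigcap_measurable => // i _.
  by rewrite -[X in measurable X]setTI; exact: measurable_coord.
by apply/seteqP; split => [v Bv i _|v Bv i]; exact: Bv.
Qed.

Lemma measurable_sub_boxes : (measurable : set (set 'cV[E]_n)) `<=`
  <<s [set box B | B in [set B | forall i, measurable (B i)]] >>.
Proof.
apply: smallest_sub; first exact: smallest_sigma_algebra.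
rewrite -bigcup_seq => C [i _ [A mA <-]]; apply: sub_sigma_algebra.
exists (fun j => if j == i then A else setT) => [j|].
  by case: ifP.
rewrite setTI; apply/seteqP; split => [v /(_ i)|v Av j]; first by rewrite eqxx.
by case: eqP => [->|].
Qed.

Lemma box_measure_unique (R : realType) (m1 m2 : {measure set 'cV[E]_n -> \bar R}) :
  (m1 setT < +oo)%E ->
  (forall B, (forall i, measurable (B i)) -> m1 (box B) = m2 (box B)) ->
  forall A, measurable A -> m1 A = m2 A.
Proof.
move=> m1T m12 A /measurable_sub_boxes.
have boxT : box (fun=> setT) = setT by apply/seteqP; split.
pose G : set (set 'cV[E]_n) := [set box B | B in [set B | forall i, measurable (B i)]].
have GT : G setT by exists (fun=> setT).
apply: (@g_sigma_algebra_measure_unique _ _ _ G _ (fun=> setT)) => //.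
- by move=> _ [B mB <-]; exact: measurable_box.
- by rewrite bigcup_const.
- move=> _ _ [B mB <-] [C mC <-]; exists (fun i => B i `&` C i).
    by move=> i; exact: measurableI.
  apply/seteqP; split => [v BC|v [Bv Cv] i]; last by split.
  by split=> i; have [] := BC i.
- by move=> _ [B mB <-]; exact: m12.
Qed.

End boxes.

Section resampling.
Context {dT dE : measure_display} {T : measurableType dT}
  {E : measurableType dE} {R : realType} {P : probability T R} {n : nat}.
Variable X : 'I_n -> {RV P >-> E}.

Definition joint (w : T) : 'cV[E]_n := \col_i X i w.

Definition resample (k : 'I_n) (vy : 'cV[E]_n * E) : 'cV[E]_n :=
  \col_i if i == k then vy.2 else vy.1 i ord0.

Lemma measurable_joint : measurable_fun setT joint.
Proof.
apply: measurable_fun_coordP => i.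
rewrite (_ : (fun _ => _) = X i) //.
by apply/funext => w; rewrite mxE.
Qed.

Lemma measurable_resample k : measurable_fun setT (resample k).
Proof.
apply: measurable_fun_coordP => i; have [<-|ik] := eqVneq i k.
  rewrite (_ : (fun _ => _) = snd) //.
  by apply/funext => v; rewrite mxE eqxx.
rewrite [X in measurable_fun _ X](_ : _ = (fun v : 'cV[E]_n => v i ord0) \o fst).
  by apply: measurableT_comp => //; exact: measurable_coord.
by apply/funext => v; rewrite mxE (negPf ik).
Qed.

HB.instance Definition _ := isMeasurableFun.Build _ _ _ _ joint measurable_joint.
HB.instance Definition _ k :=
  isMeasurableFun.Build _ _ _ _ (resample k) (measurable_resample k).

Let law := distribution P (joint : {mfun T >-> 'cV[E]_n}).

Lemma joint_box (B : 'I_n -> set E) :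
  joint @^-1` box B = \bigcap_j (X j @^-1` B j).
Proof.
apply/seteqP; split => [w Bw j _|w Bw j]; last by rewrite mxE; exact: Bw.
by have := Bw j; rewrite mxE.
Qed.

Hypothesis Xindep : mutually_independent X.

(** On a box both sides are the product of the marginal probabilities: replacing the
    coordinate of index [k] by an independent copy leaves its factor unchanged. *)
Lemma joint_resample k A : measurable A ->
  law A = (law \x distribution P (X k))%E (resample k @^-1` A).
Proof.
move=> mA.
pose Q : probability _ R := (law \x distribution P (X k))%E.
pose nu := distribution Q (resample k : {mfun _ >-> 'cV[E]_n}).
transitivity (nu A); last by [].
apply: box_measure_unique => //.
  exact: (le_lt_trans (probability_le1 law measurableT) (ltry _)).
move=> B mB.
(* [B'] is [B] with the constraint on the coordinate of index [k] removed. *)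
pose B' i := if i == k then setT else B i.
have mB' i : measurable (B' i) by rewrite /B'; case: ifP.
have RE : resample k @^-1` box B = box B' `*` B k.
  apply/seteqP; split => [[v y] /= Bvy|[v y] [/= Bv By] i].
    split=> [i|]; last by have := Bvy k; rewrite mxE eqxx.
    by rewrite /B'; have := Bvy i; rewrite mxE; case: ifP.
  by rewrite mxE; case: eqP => [->//|/eqP/negPf ik]; have := Bv i; rewrite /B' ik.
transitivity ((law \x distribution P (X k))%E (box B' `*` B k)); last by rewrite -RE.
rewrite product_measure1E//; last exact: measurable_box.
transitivity (P (joint @^-1` box B)); first by [].
transitivity (P (joint @^-1` box B') * P (X k @^-1` B k))%E; last by [].
rewrite !joint_box !Xindep//.
rewrite (bigD1 k)//= [in RHS](bigD1 k)//= /B' eqxx preimage_setT probability_setT.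
rewrite mul1e muleC; congr (_ * _)%E.
by apply: eq_bigr => i /negPf ->.
Qed.

(** Fubini: by resampling, the probability is the mean over [v] of the conditional
    probabilities, which all vanish. *)
Lemma resample_null k A : measurable A ->
  (forall v, distribution P (X k) [set y | A (resample k (v, y))] = 0%E) ->
  P (joint @^-1` A) = 0%E.
Proof.
move=> mA A0; rewrite -[LHS]/(law A) (joint_resample k)//.
rewrite [LHS]integral0_eq// => v _.
rewrite -[RHS](A0 v); congr (distribution _ _ _).
by apply/seteqP; split => y; rewrite /xsection /= inE.
Qed.

End resampling.

(** * Hyperplanes and affine independence *)

Section hyperplanes.
Context {R : realType}.

Lemma measurable_hyperplane d (u : 'cV[R]_d) (c : R) :
  measurable [set y : 'cV[R]_d | dot u y = c].
Proof.
have mf : measurable_fun setT (fun y : 'cV[R]_d => dot u y).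
  under eq_fun do rewrite dotE; apply: measurable_sum => i.
  by apply: measurable_funM => //; exact: measurable_coord.
by have := mf measurableT _ (measurable_set1 c); rewrite setTI.
Qed.

(** If the tail of the normal vector [u] is nonzero, every section at a fixed first
    coordinate is a hyperplane of smaller dimension.  Otherwise the hyperplane fixes
    the first coordinate, and the set is a point of the line times a whole space. *)
Lemma lebesgue_cV_hyperplane d (u : 'cV[R]_d) (c : R) : u != 0 ->
  lebesgue_cV d [set y | dot u y = c] = 0%E.
Proof.
elim: d u c => [|d IH] u c u0.
  by move: u0 => /eqP; case; apply/matrixP => -[].
pose u' : 'cV[R]_d := \col_i u (lift ord0 i) ord0.
have dotS x v : dot u (cons_cV (x, v)) = u ord0 ord0 * x + dot u' v.
  rewrite !dotE big_ord_recl cons_cV_ord0; congr (_ + _).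
  by apply: eq_bigr => i _; rewrite cons_cV_lift mxE.
rewrite -[LHS]/((@lebesgue_measure R \x lebesgue_cV d)%E
  (@cons_cV R d @^-1` [set y | dot u y = c])).
have [u'0|u'0] := eqVneq u' 0; last first.
  rewrite [LHS]integral0_eq// => x _.
  rewrite -(IH u' (c - u ord0 ord0 * x) u'0); congr (lebesgue_cV d _).
  apply/seteqP; split => v; rewrite /xsection /= inE /= dotS.
    by move=> <-; rewrite addrAC subrr add0r.
  by move=> ->; rewrite addrC subrK.
have u00 : u ord0 ord0 != 0.
  apply: contra_neq u0 => u00; apply/matrixP => i j; rewrite ord1 [RHS]mxE.
  have [k ->|->//] := unliftP ord0 i.
  by have /matrixP/(_ k ord0) := u'0; rewrite !mxE.
rewrite (_ : _ @^-1` _ = [set c / u ord0 ord0] `*` setT).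
  by rewrite product_measure1E// [X in (X * _)%E]lebesgue_measure_set1 mul0e.
apply/seteqP; split => [[x v]|[x v] [/= -> _]] /=.
  rewrite dotS u'0 [dot 0 v]dotE big1 ?addr0 => [<-|i _]; last by rewrite mxE mul0r.
  by split=> //=; rewrite mulrC mulKf.
rewrite dotS u'0 [dot 0 v]dotE big1 ?addr0 => [|i _]; last by rewrite mxE mul0r.
by rewrite mulrC divfK.
Qed.

End hyperplanes.

Section affine_independence.
Context {R : realType} {d : nat}.
Implicit Types x : nat -> 'cV[R]_d.

(** Its columns (1, x_j) are linearly independent exactly when the points x_j are
    affinely independent. *)
Definition affine_mx k x : 'M[R]_(1 + d, k) :=
  col_mx (const_mx 1) (\matrix_(i < d, j < k) x j i ord0).

(** Affine independence of k points is expressed by a determinant, rather than by a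
    rank, so that it is visibly a measurable condition on the points. *)
Definition gram_det k x : R := \det ((affine_mx k x)^T *m affine_mx k x).

Lemma gram_det_eq0P k x :
  (gram_det k x == 0) <-> exists2 c : 'cV[R]_k, c != 0 & affine_mx k x *m c = 0.
Proof.
set M := affine_mx k x; split => [/det0P[c c0 cM]|[c c0 Mc]].
  exists c^T; first by rewrite trmx_eq0.
  apply/eqP; rewrite -dot_eq0 /dot trmx_mul trmxK -mulmxA (mulmxA M^T).
  by rewrite mulmxA cM mul0mx mxE.
apply/det0P; exists c^T; first by rewrite trmx_eq0.
by rewrite mulmxA -trmx_mul Mc trmx0 mul0mx.
Qed.

Lemma mulmx_affine (a : R) (u : 'cV[R]_d) k x j :
  (row_mx a%:M u^T *m affine_mx k x) ord0 j = a + dot u (x j).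
Proof.
rewrite mul_row_col mxE; congr (_ + _).
  by rewrite mul_scalar_mx !mxE mulr1.
by rewrite mxE dotE; apply: eq_bigr => i _; rewrite !mxE.
Qed.

Lemma gram_det1_neq0 x : gram_det 1 x != 0.
Proof.
apply/negP => /gram_det_eq0P[c c0 Mc]; move/eqP: c0; apply.
have /matrixP/(_ (lshift d ord0) ord0) := Mc.
rewrite [in LHS]mxE big_ord1 [affine_mx _ _ _ _]col_mxEu !mxE mul1r => c00.
by apply/matrixP => i j; rewrite !ord1 c00 mxE.
Qed.

(** Since k < d+1, some nonzero (a, u) is orthogonal to the k vectors (1, x_j), and
    u <> 0 because k > 0.  If (1, x_k) depends linearly on these independent
    vectors, then it is orthogonal to (a, u) as well: x_k is on the hyperplane
    u.y = -a.  Quantifying over [x'] makes this hyperplane independent of x_k. *)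
Lemma gram_det_hyperplane k x : (0 < k <= d)%N -> gram_det k x != 0 ->
  exists (u : 'cV[R]_d) (c : R), u != 0 /\
    forall x', (forall j, (j < k)%N -> x' j = x j) ->
      gram_det k.+1 x' = 0 -> dot u (x' k) = c.
Proof.
move=> /andP[k0 kd] Gk.
have [r r0 rM] : exists2 r : 'rV[R]_(1 + d), r != 0 & r *m affine_mx k x = 0.
  have /rowV0Pn[r] : kermx (affine_mx k x) != 0.
    by rewrite kermx_eq0 -row_leq_rank -ltnNge (leq_ltn_trans (rank_leq_col _)).
  by rewrite sub_kermx => /eqP rM r0; exists r.
pose a := r ord0 (lshift d ord0); pose u := (rsubmx r)^T.
have rE : r = row_mx a%:M u^T.
  rewrite -[LHS]hsubmxK trmxK; congr row_mx.
  by apply/matrixP => i j; rewrite !ord1 !mxE eqxx mulr1n.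
have rz j : (j < k)%N -> a + dot u (x j) = 0.
  by move=> jk; rewrite -(mulmx_affine a u x (Ordinal jk)) -rE rM mxE.
exists u, (- a); split.
  apply: contra_neq r0 => u0; have := rz 0%N k0.
  rewrite rE u0 dotE big1 ?addr0 => [->|i _]; last by rewrite mxE mul0r.
  by rewrite trmx0 raddf0 row_mx0.
move=> x' x'x /eqP/gram_det_eq0P[c c0 Mc].
(* A dependency that avoids the last column would be one among the first k. *)
have ck : c ord_max ord0 != 0.
  apply: contra_neq c0 => ck0.
  pose c' : 'cV[R]_k := \col_j c (widen_ord (leqnSn k) j) ord0.
  suff c'0 : c' = 0.
    apply/matrixP => i l; rewrite ord1 [RHS]mxE.
    have [j|ij] := unliftP ord_max i; last by rewrite ij.
    move=> ->; have /matrixP/(_ j ord0) := c'0; rewrite !mxE => <-.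
    by congr (c _ _); apply: val_inj; rewrite /= /bump leqNgt ltn_ord.
  apply: contraNeq Gk => c'0; apply/gram_det_eq0P; exists c' => //.
  apply/matrixP => i l; rewrite ord1; have /matrixP/(_ i ord0) := Mc.
  rewrite !mxE big_ord_recr /= ck0 mulr0 addr0 => E.
  rewrite -[RHS]E; apply: eq_bigr => j _; rewrite [c' _ _]mxE; congr (_ * _).
  by rewrite !mxE; case: fintype.split => i'; rewrite !mxE//= x'x.
have /matrixP/(_ ord0 ord0) : row_mx a%:M u^T *m (affine_mx k.+1 x' *m c) = 0.
  by rewrite Mc mulmx0.
rewrite mulmxA mxE big_ord_recr /= big1 ?add0r => [|j _]; last first.
  by rewrite mulmx_affine /= x'x// rz// mul0r.
rewrite mulmx_affine mxE => /eqP; rewrite mulf_eq0 (negPf ck) orbF.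
by rewrite addrC addr_eq0 => /eqP.
Qed.

End affine_independence.

(** * Almost sure regularity *)

Section regular_samples.
Context {R : realType} {d n : nat}.

(** A vector [u] killed by the sample covariance is orthogonal to all centred
    observations, so (-m.u, u), for m the sample mean, is orthogonal to the d+1
    independent vectors (1, x_j). *)
Lemma gram_det_regular (x : 'I_n.+1 -> 'cV[R]_d) : (d <= n)%N -> injective x ->
  gram_det d.+1 (fun i => x (inord i)) != 0 -> regular_sample x.
Proof.
move=> dn xinj G; split => //; rewrite unitmxE unitfE.
apply/negP => /det0P[v v0 vS].
pose u := v^T.
have Su : sample_cov x *m u = 0.
  by rewrite -[sample_cov x]sample_cov_sym -trmx_mul vS trmx0.
pose z j := x j - sample_mean x.
have zu j : dot (z j) u = 0.
  have : dot u (sample_cov x *m u) = 0.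
    by rewrite Su dotC -(scale0r u) dotZl mul0r.
  rewrite dot_sample_cov => /eqP; rewrite mulf_eq0 invr_eq0 pnatr_eq0/=.
  rewrite psumr_eq0 => [/allP z0|i _]; last exact: sqr_ge0.
  by have := z0 j (mem_index_enum j); rewrite /= sqrf_eq0 => /eqP.
pose M : 'M[R]_(d.+1) := affine_mx d.+1 (fun i => x (inord i)).
have Mu : M \in unitmx.
  move: G; rewrite /gram_det -/M -[X in \det X]/(M^T *m M) det_mulmx mulf_eq0 negb_or.
  by rewrite unitmxE unitfE => /andP[].
pose r : 'rV[R]_(1 + d) := row_mx (- dot (sample_mean x) u)%:M u^T.
have rM : (r : 'rV[R]_(d.+1)) *m M = 0.
  apply/matrixP => i j; rewrite ord1 [RHS]mxE.
  rewrite -[LHS]/((r *m affine_mx d.+1 (fun i => x (inord i))) ord0 j) mulmx_affine.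
  by rewrite addrC [dot u _]dotC -dotNl -dotDl zu.
have : (r : 'rV[R]_(d.+1)) = 0 by rewrite -[LHS](mulmxK Mu) rM mul0mx.
move=> /(congr1 (fun r : 'rV[R]_(1 + d) => rsubmx r)); rewrite row_mxKr linear0 trmxK.
by move/eqP: v0.
Qed.

Lemma measurable_gram_det (k : nat) :
  measurable_fun setT (fun v : 'cV['cV[R]_d]_n.+1 =>
    gram_det k (fun i => v (inord i) ord0)).
Proof.
rewrite /gram_det /determinant; apply: measurable_sum => s.
apply: measurable_funM => //; apply: measurable_prod => i _.
under eq_fun do rewrite mxE; apply: measurable_sum => l.
have mM (j : 'I_k) : measurable_fun setT (fun v : 'cV['cV[R]_d]_n.+1 =>
    affine_mx k (fun i => v (inord i) ord0) l j).
  rewrite /affine_mx -(@fintype.splitK 1 d l); case: (@fintype.split 1 d l) => l' /=.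
    by under eq_fun do rewrite col_mxEu mxE; exact: measurable_cst.
  under eq_fun do rewrite col_mxEd mxE.
  by apply: (measurableT_comp (measurable_coord l') (measurable_coord (inord j))).
under eq_fun do rewrite mxE; exact: measurable_funM.
Qed.

End regular_samples.

Section almost_sure_regularity.
Context {R : realType} {dT : measure_display} {T : measurableType dT}
  {P : probability T R} {d n : nat}.
Variable X : 'I_n.+1 -> {RV P >-> 'cV[R]_d}.
Hypothesis Xindep : mutually_independent X.
Hypothesis Xac : forall j, distribution P (X j) `<< lebesgue_cV d.

(** The hyperplane may depend on the other coordinates [v]: each conditional
    probability vanishes by absolute continuity. *)
Lemma ae_not_resample_hyperplane k (Z : set 'cV['cV[R]_d]_n.+1) : measurable Z ->
  (forall v, exists (u : 'cV[R]_d) (c : R), u != 0 /\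
     forall y, Z (resample k (v, y)) -> dot u y = c) ->
  {ae P, forall w, ~ Z (joint X w)}.
Proof.
move=> mZ ZH.
have mJ : measurable (joint X @^-1` Z).
  by rewrite -[X in measurable X]setTI; exact: measurable_joint.
exists (joint X @^-1` Z); split => //; last by move=> w /= /contrapT.
apply: (resample_null Xindep (k := k)) => // v.
have [u [c [u0 uc]]] := ZH v.
have /null_content_dominatesP Xk := Xac k.
have hyp0 := Xk _ (measurable_hyperplane u c) (lebesgue_cV_hyperplane c u0).
have mS : measurable [set y | Z (resample k (v, y))].
  have := measurable_xsection v (measurable_resample k measurableT mZ).
  by rewrite setTI xsectionE.
apply/eqP; rewrite eq_le measure_ge0 andbT -hyp0.
by apply: le_measure; rewrite ?inE//; exact: measurable_hyperplane.
Qed.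

Lemma ae_regular_sample : (0 < d <= n)%N -> {ae P, forall w, regular_sample (X ^~ w)}.
Proof.
move=> /andP[d0 dn].
(* Two equal observations agree in the coordinate [l0], which already places one of
   them on a hyperplane determined by the other. *)
pose l0 := Ordinal d0.
have distinct i j : {ae P, forall w, i != j -> X i w <> X j w}.
  have [->|ij] := eqVneq i j; first by apply: aeW => w.
  pose Z := [set v : 'cV['cV[R]_d]_n.+1 | v i ord0 l0 ord0 - v j ord0 l0 ord0 = 0].
  have mZ : measurable Z.
    have mf : measurable_fun setT (fun v : 'cV['cV[R]_d]_n.+1 =>
        v i ord0 l0 ord0 - v j ord0 l0 ord0).
      by apply: measurable_funB;
        exact: (measurableT_comp (measurable_coord l0) (measurable_coord _)).
    by have := mf measurableT _ (measurable_set1 0); rewrite setTI.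
  apply: filterS (ae_not_resample_hyperplane (k := i) mZ _).
    by move=> w nZ _ Xij; apply: nZ; rewrite /Z /= !mxE Xij subrr.
  move=> v; exists (delta_mx l0 ord0), (v j ord0 l0 ord0); split.
    apply/eqP => /matrixP/(_ l0 ord0)/eqP; rewrite !mxE !eqxx oner_eq0 //.
  move=> y; rewrite /Z /= dot_delta !mxE eqxx eq_sym (negPf ij) => /eqP.
  by rewrite subr_eq0 => /eqP.
pose G k w := gram_det k (fun i => X (inord i) w).
have step (k : 'I_n.+1) : {ae P, forall w,
    (0 < k <= d)%N -> G k w != 0 -> G k.+1 w != 0}.
  have [kd|kd] := boolP (0 < k <= d)%N; last by apply: aeW => w.
  pose g m (v : 'cV['cV[R]_d]_n.+1) := gram_det m (fun i => v (inord i) ord0).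
  pose Z := [set v | g k v != 0 /\ g k.+1 v = 0].
  have mZ : measurable Z.
    have -> : Z = g k @^-1` (~` [set 0]) `&` g k.+1 @^-1` [set 0].
      apply/seteqP; split => v [/= gk gk1]; split => //; first by apply/eqP.
      exact/eqP.
    have mg m := @measurable_gram_det R d n m.
    apply: measurableI.
      have := mg k measurableT _ (measurableC (measurable_set1 0)); rewrite setTI; exact.
    have := mg k.+1 measurableT _ (measurable_set1 0); rewrite setTI; exact.
  have gE w m : g m (joint X w) = G m w.
    by rewrite /g /G; congr gram_det; apply/funext => i; rewrite mxE.
  apply: filterS (ae_not_resample_hyperplane (k := k) mZ _).
    move=> w nZ _ Gk; apply/eqP => Gk1; apply: nZ; rewrite /Z /= !gE; split => //.
  move=> v.
  have agree y (j : nat) : (j < k)%N ->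
      resample k (v, y) (inord j) ord0 = v (inord j) ord0.
    move=> jk; rewrite mxE; case: eqP => // /(congr1 val).
    by rewrite /= inordK ?(ltn_trans jk)// => jk'; rewrite jk' ltnn in jk.
  (* If the first k points of [v] are dependent, no [y] gives a point of [Z], so any
     hyperplane will do. *)
  have [gk0|gk0] := eqVneq (g k v) 0.
    exists (delta_mx l0 ord0), 0; split.
      by apply/eqP => /matrixP/(_ l0 ord0)/eqP; rewrite !mxE !eqxx oner_eq0.
    move=> y [/eqP gk _]; case: gk; rewrite -gk0 /g /gram_det.
    suff -> : affine_mx k (fun i => resample k (v, y) (inord i) ord0) =
              affine_mx k (fun i => v (inord i) ord0) by [].
    congr col_mx; apply/matrixP => i j; rewrite !mxE.
    by have := agree y j (ltn_ord j); rewrite mxE => ->.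
  have [u [c [u0 uc]]] := gram_det_hyperplane kd gk0.
  exists u, c; split => // y [_ gk1].
  have := uc _ (agree y) gk1.
  by rewrite mxE inord_val eqxx.
have D : {ae P, forall w, forall i j, i != j -> X i w <> X j w}.
  by apply: filter_forall => i; apply: filter_forall => j; exact: distinct.
have S : {ae P, forall w, forall k : 'I_n.+1,
    (0 < k <= d)%N -> G k w != 0 -> G k.+1 w != 0}.
  by apply: filter_forall => k; exact: step.
apply: filterS2 D S => w Dw Sw; apply: gram_det_regular => //.
  by move=> i j Xij; apply/eqP/negP => /negP/Dw.
suff H k : (k <= d)%N -> G k.+1 w != 0 by exact: H.
elim: k => [|k IH] kd; first exact: gram_det1_neq0.
have kn : (k.+1 < n.+1)%N by rewrite ltnS (leq_trans kd).
exact: (Sw (Ordinal kn) kd (IH (ltnW kd))).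
Qed.

End almost_sure_regularity.

Theorem theorem2p1 (R : realType) (dT : measure_display)
    (T : measurableType dT) (P : probability T R) (d n : nat)
    (X : 'I_n -> {RV P >-> 'cV[R]_d}) :
  (1 <= d)%N -> (d + 1 <= n)%N ->
  mutually_independent X -> identically_distributed X ->
  (forall j, distribution P (X j) `<< lebesgue_cV d) ->
  {ae P, forall w, regular_sample (X ^~ w)} /\
  forall w, regular_sample (X ^~ w) ->
    (fun a : R => ((a / pi) `^ (d%:R / 2))%:E * statU (X ^~ w) a
                  - (d%:R * (d%:R + 2) / (4 * a ^+ 2))%:E)%E @ 0^'+
    --> (n%:R^-1 * (\sum_(j < n) enorm (residual (X ^~ w) j) ^+ 4)
         - d%:R ^+ 2)%:E.
Proof.
move=> d0 dn Xindep _ Xac; have n0 : (0 < n)%N by rewrite (leq_trans _ dn)// addn1.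
split=> [|w [Xinj Su]].
  case: n => [//|n] in X dn Xindep Xac n0 *.
  by apply: ae_regular_sample => //; rewrite d0 -ltnS -addn1.
by apply: statU_cvg => //; [exact: residual_inj|exact: sum_residual_sqr].
Qed.
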